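(* Let $n\ge2$ and let $\mathcal{S}$ be a (nonempty) connected real analytic submanifold of $\mathbb{R}^n$ of dimension at least $2$ which is not contained in any proper rational affine subspace of $\mathbb{R}^n$. Then $\mathcal{S}$ is locally closed and there are collections $\{L_i\}$, $\{L'_j\}$, $\{A_i\}$ forming a Khintchine system for $\mathcal{S}$ (defined in the context). In particular: (1) for every $\Phi:\mathbb{Z}^n\smallsetminus\{\boldsymbol{0}\}\to\mathbb{R}_+$ such that $\{\boldsymbol{q}:\Phi(\boldsymbol{q})\le C\}$ is finite for every $C>0$, and every non-increasing $\varphi:\mathbb{R}_+\to\mathbb{R}_+$, there exist uncountably many totally irrational $\boldsymbol{\xi}\in\mathcal{S}$ such that $\psi_{\Phi,\boldsymbol{\xi}}(t)\le\varphi(t)$ for all large enough $t$; (2) there exist uncountably many totally irrational $\boldsymbol{\xi}\in\mathcal{S}$ with $\hat{\omega}^*(\boldsymbol{\xi})=\infty$; (3) there exist uncountably many totally irrational $\boldsymbol{\xi}\in\mathcal{S}$ with $\hat{\omega}(\boldsymbol{\xi})\ge\frac1{n-1}$; (4) for every $\boldsymbol{s}=(s_1,\ldots,s_n)\in(0,1)^n$ with $\sum_js_j=1$, there exist uncountably many totally irrational $\boldsymbol{\xi}\in\mathcal{S}$ with $\hat{\omega}^*_{\boldsymbol{s}}(\boldsymbol{\xi})=\infty$; (5) for every such $\boldsymbol{s}$, with $\delta=\min_js_j$, there exist uncountably many totally irrational $\boldsymbol{\xi}\in\mathcal{S}$ with $\hat{\omega}_{\boldsymbol{s}}(\boldsy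mbol{\xi})\ge\frac{1}{n(1-\delta)}$.
   Context: Real analytic submanifolds: for $k\le n$ and $\mathcal{U}\subset\mathbb{R}^k$ open, a map $f:\mathcal{U}\to\mathbb{R}^n$ is a real analytic immersion if it is injective, each coordinate function is infinitely differentiable with Taylor series converging (to it) in a neighborhood of every point of $\mathcal{U}$, and the derivative $d_{\boldsymbol{x}}f$ has rank $k$ at every $\boldsymbol{x}\in\mathcal{U}$. A $k$-dimensional real analytic submanifold of $\mathbb{R}^n$ is a subset $\mathcal{M}\subset\mathbb{R}^n$ such that for every $\boldsymbol{\xi}\in\mathcal{M}$ there are a neighborhood $\mathcal{V}\subset\mathbb{R}^n$ of $\boldsymbol{\xi}$, an open $\mathcal{U}\subset\mathbb{R}^k$ and a real analytic immersion $f:\mathcal{U}\to\mathbb{R}^n$, which is a homeomorphism onto its image, with $\mathcal{V}\cap\mathcal{M}=f(\mathcal{U})$. A rational affine subspace is an affine subspace of $\mathbb{R}^n$ defined by linear equations with rational coefficients and constant terms. A set $S\subset\mathbb{R}^n$ is locally closed if $S=\overline{S}\cap\mathcal{W}$ for some open $\mathcal{W}\subset\mathbb{R}^n$. $\mathbb{R}_+$ denotes the positive reals. Write $\|\boldsymbol{x}\|=\max_j|x_j|$, $\boldsymbol{x}\cdot\boldsymbol{y}=\sum_jx_jy_j$; for $x\in\mathbb{R}$ let $\langle x\rangle$ be the distance from $x$ to the nearest integer, and $\langle\boldsymbol{x}\rangle=(\langle x_1\rangle,\ldots,\langle x_n\rangle)$. For a primitive vector $\mathbf{m}=(m_0,m_1,\ldots,m_n)\in\mathbb{Z}^{n+1}$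 with $(m_1,\ldots,m_n)\neq 0$, put $A_{\mathbf{m}}=\{\boldsymbol{\xi}\in\mathbb{R}^n:\sum_{i=1}^n m_i\xi_i=m_0\}$ and $|A_{\mathbf{m}}|=\|(m_1,\ldots,m_n)\|$. The sets $A_{\mathbf{m}}$ are the rational affine hyperplanes. Khintchine system for a set $S$: disjoint (countable) collections $\{L_1,L_2,\ldots\}$ and $\{L'_1,L'_2,\ldots\}$ of distinct closed subsets of $S$ (closed in $S$), each contained in a rational affine hyperplane, together with, for each $i$, a rational affine hyperplane $A_i\supset L_i$, such that (closures taken in $S$): (a) $\bigcup_i L_i\cup\bigcup_j L'_j=\{\boldsymbol{x}\in S:\boldsymbol{x}\text{ is contained in a rational affine hyperplane}\}$; (b) for each $i$ and each $T>0$, $L_i=\overline{\bigcup_{j:\,|A_j|>T}(L_i\cap L_j)}$; (c) for each $i$ and any finite sets of indices $F,F'$ with $i\notin F$, $L_i=\overline{L_i\smallsetminus(\bigcup_{k\in F}L_k\cup\bigcup_{k'\in F'}L'_{k'})}$; (d) $\bigcup_i L_i$ is dense in $S$. A vector $\boldsymbol{\xi}\in\mathbb{R}^n$ is totally irrational if $1,\xi_1,\ldots,\xi_n$ are linearly independent over $\mathbb{Q}$. Define $\psi_{\Phi,\boldsymbol{\xi}}(t)=\min\{\langle\boldsymbol{q}\cdot\boldsymbol{\xi}\rangle:\boldsymbol{q}\in\mathbb{Z}^n\smallsetminus\{\boldsymbol{0}\},\ \Phi(\boldsymbol{q})\le t\}$ (for $t$ large enough that this set is nonempty). Exponents (all are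 suprema, possibly $\infty$): $\hat{\omega}(\boldsymbol{\xi})$ is the supremum of $\gamma>0$ such that for all large $t$ there is an integer $q$ with $0<q\le t$, $\|\langle q\boldsymbol{\xi}\rangle\|\le t^{-\gamma}$; $\hat{\omega}^*(\boldsymbol{\xi})$ is the supremum of $\gamma>0$ such that for all large $t$ there is $\boldsymbol{q}\in\mathbb{Z}^n$ with $0<\|\boldsymbol{q}\|\le t$, $\langle\boldsymbol{q}\cdot\boldsymbol{\xi}\rangle\le t^{-\gamma}$. With $\|\boldsymbol{x}\|_{\boldsymbol{s}}=\max_j|x_j|^{1/s_j}$: $\hat{\omega}_{\boldsymbol{s}}(\boldsymbol{\xi})$ is the supremum of $\gamma$ such that for all large $t$ there is an integer $q$ with $0<q\le t$, $\|\langle q\boldsymbol{\xi}\rangle\|_{\boldsymbol{s}}\le t^{-n\gamma}$; $\hat{\omega}^*_{\boldsymbol{s}}(\boldsymbol{\xi})$ is the supremum of $\gamma$ such that for all large $t$ there is $\boldsymbol{q}\in\mathbb{Z}^n$ with $0<\|\boldsymbol{q}\|_{\boldsymbol{s}}\le t^n$, $\langle\boldsymbol{q}\cdot\boldsymbol{\xi}\rangle\le t^{-\gamma}$. *)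

(* Defs.v *)
From HB Require Import structures.
From mathcomp Require Import all_boot all_order all_algebra finmap.
From mathcomp Require Import all_classical all_reals all_analysis.
From mathcomp Require summability.

Set Implicit Arguments.
Unset Strict Implicit.
Unset Printing Implicit Defensive.

Import Order.TTheory GRing.Theory Num.Theory.
Import numFieldNormedType.Exports.

Local Open Scope classical_set_scope.
Local Open Scope ring_scope.

(* R^n is 'rV[R]_n; its library norm `|x| is max_j |x_j| and its topology is
   the usual one. *)

(* For s = [:: j1; ...; jr], the iterated partial derivative
   d/dx_{j1} (... (d/dx_{jr} g)). *)
Definition pderivs (R : realType) (k : nat) (s : seq 'I_k)
    (g : 'rV[R]_k -> R) : 'rV[R]_k -> R :=
  foldr (fun j h x => 'D_('e_j) h x) g s.

Definition smooth_on (R : realType) (k : nat) (U : set 'rV[R]_k)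
    (g : 'rV[R]_k -> R) : Prop :=
  forall (s : seq 'I_k) (x : 'rV[R]_k), U x -> differentiable (pderivs s g) x.

Definition index_seq (k : nat) (a : {ffun 'I_k -> nat}) : seq 'I_k :=
  flatten [seq nseq (a j) j | j <- enum 'I_k].

Definition taylor_term (R : realType) (k : nat) (g : 'rV[R]_k -> R)
    (x y : 'rV[R]_k) (a : {ffun 'I_k -> nat}) : R :=
  pderivs (index_seq a) g x / (\prod_(j < k) (a j)`!)%:R
    * \prod_(j < k) (y 0 j - x 0 j) ^+ a j.

(* A power series in several variables has no preferred order of summation:
   its sum is the unconditional one, i.e. the limit of the finite partial sums
   along the directed set of finite sets of multi-indices. *)
Definition real_analytic_on (R : realType) (k : nat) (U : set 'rV[R]_k)
    (g : 'rV[R]_k -> R) : Prop :=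
  smooth_on U g /\
  forall x, U x -> \forall y \near x,
    summability.partial_sum (taylor_term g x y) @ summability.totally --> g y.

Definition analytic_immersion (R : realType) (k n : nat) (U : set 'rV[R]_k)
    (f : 'rV[R]_k -> 'rV[R]_n) : Prop :=
  [/\ set_inj U f,
      forall j : 'I_n, real_analytic_on U (fun x => f x 0 j) &
      forall x, U x -> \rank ('J f x) = k].

Definition homeomorphism_onto_image (T T' : topologicalType) (U : set T)
    (f : T -> T') : Prop :=
  {within U, continuous f} /\
  exists g : T' -> T,
    {in U, cancel f g} /\ {within f @` U, continuous g}.

Definition analytic_submanifold (R : realType) (n k : nat)
    (M : set 'rV[R]_n) : Prop :=
  (k <= n)%N /\
  forall xi, M xi ->
    exists (V : set 'rV[R]_n) (U : set 'rV[R]_k) (f : 'rV[R]_k -> 'rV[R]_n),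
      [/\ nbhs xi V, open U, analytic_immersion U f,
          homeomorphism_onto_image U f & V `&` M = f @` U].

(* The solution set of p linear equations, one per column of B. *)
Definition rational_affine_subspace (R : realType) (n : nat)
    (A : set 'rV[R]_n) : Prop :=
  exists (p : nat) (B : 'M[rat]_(n, p)) (c : 'rV[rat]_p),
    A = [set x | x *m map_mx ratr B = map_mx ratr c].

Definition locally_closed (T : topologicalType) (S : set T) : Prop :=
  exists2 W : set T, open W & S = closure S `&` W.

Definition rel_closed (T : topologicalType) (S X : set T) : Prop :=
  exists2 C : set T, closed C & X = S `&` C.

Definition rel_closure (T : topologicalType) (S X : set T) : set T :=
  S `&` closure X.

(* A vector (m_0, m_1, ..., m_n) of Z^(n+1) is m : 'rV[int]_n.+1 with
   m_0 = m 0 ord0; its normal part is (m_1, ..., m_n). *)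
Definition normal_part (n : nat) (m : 'rV[int]_n.+1) : 'rV[int]_n :=
  \row_(i < n) m 0 (lift ord0 i).

Definition hyperplane_vector (n : nat) (m : 'rV[int]_n.+1) : Prop :=
  \big[gcdn/0%N]_(i < n.+1) absz (m 0 i) = 1%N /\ normal_part m != 0.

Definition dotz (R : realType) (n : nat) (q : 'rV[int]_n) (x : 'rV[R]_n) : R :=
  \sum_(j < n) (q 0 j)%:~R * x 0 j.

Definition znorm (R : realType) (n : nat) (q : 'rV[int]_n) : R :=
  `|(map_mx intr q : 'rV[R]_n)|.

Definition hyperplane (R : realType) (n : nat) (m : 'rV[int]_n.+1) :
    set 'rV[R]_n :=
  [set x | dotz (normal_part m) x = (m 0 ord0)%:~R].

(* The height |A_m|; since m is primitive, A_m determines m up to sign. *)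
Definition height (R : realType) (n : nat) (m : 'rV[int]_n.+1) : R :=
  znorm R (normal_part m).

Definition in_rational_hyperplane (R : realType) (n : nat)
    (X : set 'rV[R]_n) : Prop :=
  exists2 m : 'rV[int]_n.+1, hyperplane_vector m & X `<=` hyperplane m.

(* The families are (L i), i in I, and (L' j), j in J, for sets I and J of
   natural numbers, so that each of them may be finite or infinite.  The
   hyperplane A_i is given by the primitive vector m i. *)
Record Khintchine_system (R : realType) (n : nat) (S : set 'rV[R]_n)
    (I J : set nat) (L L' : nat -> set 'rV[R]_n)
    (m : nat -> 'rV[int]_n.+1) : Prop := {
  Khintchine_distinct : set_inj I L;
  Khintchine_distinct' : set_inj J L';
  Khintchine_disjoint : forall i j, I i -> J j -> L i <> L' j;
  Khintchine_closed : forall i, I i -> rel_closed S (L i);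
  Khintchine_closed' : forall j, J j -> rel_closed S (L' j);
  Khintchine_hyperplane : forall i, I i ->
    hyperplane_vector (m i) /\ L i `<=` hyperplane (m i);
  Khintchine_hyperplane' : forall j, J j -> in_rational_hyperplane (L' j);
  Khintchine_a :
    \bigcup_(i in I) L i `|` \bigcup_(j in J) L' j =
    [set x | S x /\ in_rational_hyperplane [set x]];
  Khintchine_b : forall i, I i -> forall T : R, 0 < T ->
    L i = rel_closure S
      (\bigcup_(j in [set j | I j /\ T < height R (m j)]) (L i `&` L j));
  Khintchine_c : forall i, I i -> forall F F' : set nat,
    finite_set F -> finite_set F' -> F `<=` I -> F' `<=` J -> ~ F i ->
    L i = rel_closure S
      (L i `\` (\bigcup_(k in F) L k `|` \bigcup_(k in F') L' k));
  Khintchine_d : rel_closure S (\bigcup_(i in I) L i) = S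
}.

Definition totally_irrational (R : realType) (n : nat) (xi : 'rV[R]_n) : Prop :=
  forall (c : rat) (a : 'rV[rat]_n),
    ratr c + \sum_(j < n) ratr (a 0 j) * xi 0 j = 0 -> c = 0 /\ a = 0.

(* The distance to the nearest integer. *)
Definition dist_int (R : realType) (x : R) : R :=
  inf [set `|x - z%:~R| | z in [set: int]].

Definition dist_intv (R : realType) (n : nat) (x : 'rV[R]_n) : 'rV[R]_n :=
  map_mx (@dist_int R) x.

(* When [set q | q != 0 & Phi q <= t] is finite and nonempty, this infimum is
   a minimum; the value of Phi at 0 plays no role. *)
Definition irrationality_fun (R : realType) (n : nat) (Phi : 'rV[int]_n -> R)
    (xi : 'rV[R]_n) (t : R) : R :=
  inf [set dist_int (dotz q xi) | q in [set q | q != 0 /\ Phi q <= t]].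

Definition weighted_norm (R : realType) (n : nat) (s x : 'rV[R]_n) : R :=
  \big[Num.max/0]_(j < n) `|x 0 j| `^ (s 0 j)^-1.

Definition omega_hat (R : realType) (n : nat) (xi : 'rV[R]_n) : \bar R :=
  ereal_sup [set g%:E | g in [set g : R | 0 < g /\
    \forall t \near +oo, exists q : int,
      [/\ 0 < q, q%:~R <= t & `|dist_intv (q%:~R *: xi)| <= t `^ (- g)]]].

Definition omega_hat_star (R : realType) (n : nat) (xi : 'rV[R]_n) : \bar R :=
  ereal_sup [set g%:E | g in [set g : R | 0 < g /\
    \forall t \near +oo, exists q : 'rV[int]_n,
      [/\ 0 < znorm R q, znorm R q <= t &
          dist_int (dotz q xi) <= t `^ (- g)]]].

Definition weighted_omega_hat (R : realType) (n : nat) (s xi : 'rV[R]_n) :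
    \bar R :=
  ereal_sup [set g%:E | g in [set g : R |
    \forall t \near +oo, exists q : int,
      [/\ 0 < q, q%:~R <= t &
          weighted_norm s (dist_intv (q%:~R *: xi)) <= t `^ (- (n%:R * g))]]].

Definition weighted_omega_hat_star (R : realType) (n : nat)
    (s xi : 'rV[R]_n) : \bar R :=
  ereal_sup [set g%:E | g in [set g : R |
    \forall t \near +oo, exists q : 'rV[int]_n,
      [/\ 0 < weighted_norm s (map_mx intr q),
          weighted_norm s (map_mx intr q) <= t ^+ n &
          dist_int (dotz q xi) <= t `^ (- g)]]].

Definition weights (R : realType) (n : nat) (s : 'rV[R]_n) : Prop :=
  (forall j, 0 < s 0 j < 1) /\ \sum_(j < n) s 0 j = 1.

(* Seeding the minimum with 1 is harmless: the weights are less than 1. *)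
Definition min_weight (R : realType) (n : nat) (s : 'rV[R]_n) : R :=
  \big[Num.min/1]_(j < n) s 0 j.

Definition uncountably_many (T : Type) (P : T -> Prop) : Prop :=
  ~ countable [set x | P x].

(* Main.v *)
Require Import Defs.
From mathcomp Require Import finmap.
From mathcomp Require Import all_boot all_order all_algebra.
From mathcomp Require Import all_classical all_reals all_analysis.
From mathcomp Require summability.
From mathcomp Require Import zify ring lra.

Set Implicit Arguments.
Unset Strict Implicit.
Unset Printing Implicit Defensive.
Import Order.TTheory GRing.Theory Num.Theory.
Import numFieldNormedType.Exports.
Local Open Scope classical_set_scope.
Local Open Scope ring_scope.

(** The idea is to reduce the existence of a Khintchine system to the geometry
    of lines of integral slope in the plane.

    Since S has dimension at least 2, near each of its points some pair (a, b)
    of coordinates restricts to a submersion of S to the plane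
    ([regular_pair_exists], [regular_pair_values]).  There are finitely many
    pairs, so a dense open part of S splits into disjoint open regions, one for
    each pair.  Inside the region of (a, b), S is cut by the hyperplanes
    x_b + al x_a = c with al and c integers; the vector (c; al at a, 1 at b) is
    primitive because it has an entry equal to 1.  The sets L_i are the closures
    in S of these cuts.  What a Khintchine system demands of the L_i among
    themselves holds because it holds for the lines x_b + al x_a = c of the
    plane: their union is dense, two of them meet in at most one point, and each
    point of a line is a limit of its crossings with ever steeper lines.

    The sets L'_j have to cover the rest of every rational hyperplane section
    without filling an open piece of any L_i.  For a rational hyperplane A, take
    the part of S meeting A that remains after removing the relative interiors
    of all the L_i ([residue]).  If it did fill an open piece of some L_i, then
    A would contain that piece; but S, being connected and not contained in A,
    is nowhere locally contained in A ([hyperplane_not_locally_containing]), and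
    an analytic function that vanishes on a smooth hypersurface without being
    locally zero has, near a suitable point, no zero off that hypersurface
    ([jet_zero_set_local]: take the least order of vanishing).  So near that
    point the section by A is L_i, and the point was removed.

    Given a Khintchine system on a locally closed set, Khintchine's nested balls
    ([singular_point_exists]) produce points whose irrationality function is eventually
    below a given phi: move from L_i to an L_j crossing it, with A_j of much larger height; near the crossing
    the linear form of A_i is as close to an integer as desired, hence good
    enough until the form of A_j takes over.  The balls are chosen to miss, one
    by one, all the L_k, all the L'_k and the members of any given countable
    set, so the points are totally irrational and uncountably many.

    For phi(t) = exp(-t) these points have infinite uniform dual exponents, with
    or without weights.  The lower bounds for the exponents of simultaneous
    approximation follow from them by transference: when q.xi is extremely close to an integer, the
    pigeonhole principle of Dirichlet in the n - 1 coordinates other than some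
    j0, combined with a congruence modulo q_j0, gives simultaneous
    approximations to all n coordinates ([dirichlet_near_hyperplane],
    [weighted_transference]). *)

(** * Simultaneous approximation near a rational hyperplane *)

Lemma dist_int_le (R : realType) (x : R) (z : int) :
  dist_int x <= `|x - z%:~R|.
Proof.
apply: ge_inf; last by exists z.
by exists 0 => _ [w _ <-].
Qed.

Lemma dist_int_ge0 (R : realType) (x : R) : 0 <= dist_int x.
Proof.
apply: lb_le_inf; first by exists `|x - 0%:~R|, 0.
by move=> _ [w _ <-].
Qed.

Lemma dist_int_near (R : realType) (x e : R) :
  dist_int x < e -> exists z : int, `|x - z%:~R| < e.
Proof.
move=> xe; have xinf : has_inf [set `|x - z%:~R| | z in [set: int]].
  by split; [exists `|x - 0%:~R|, 0|exists 0 => _ [w _ <-]].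
have e0 : 0 < e - dist_int x by rewrite subr_gt0.
have [_ [z _ <-] ze] := inf_adherent e0 xinf; exists z.
by rewrite (lt_le_trans ze)// addrC subrK.
Qed.

Lemma frac_bounds (R : realType) (x : R) :
  0 <= x - (Num.floor x)%:~R < 1.
Proof. by have /andP[a b] := floor_itv x; rewrite intrD in b; rewrite subr_ge0 a ltrBlDl. Qed.

Lemma same_box_lt (R : realType) (N : nat) (e u v : R) :
  1 < N%:R * e -> 0 <= u -> 0 <= v ->
  Num.truncn (u * N%:R) = Num.truncn (v * N%:R) -> `|u - v| < e.
Proof.
move=> Ne u0 v0 uv.
have N0 : 0 < N%:R :> R.
  by rewrite lt_def ler0n andbT; apply/eqP => N0; move: Ne; rewrite N0 mul0r ltr10.
have /andP[a1 a2] := truncn_itv (mulr_ge0 u0 (ltW N0)).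
have /andP[b1 b2] := truncn_itv (mulr_ge0 v0 (ltW N0)).
rewrite uv in a1 a2; rewrite -natr1 in a2 b2.
have : `|(u - v) * N%:R| < 1 by rewrite mulrBl ltr_norml; apply/andP; split; lra.
rewrite normrM (ger0_norm (ltW N0)) => h.
by rewrite -(ltr_pM2r N0) (lt_trans h)// mulrC.
Qed.

(** Pigeonhole for boxes whose number of cells depends on the coordinate: the
    common bound [M] makes the labels a finite type. *)
Lemma box_collision (Q n M : nat) (N : 'I_n -> nat) (f : nat -> 'I_n -> nat) :
  (\prod_j N j <= Q)%N -> (forall x j, f x j < N j)%N -> (forall j, N j <= M)%N ->
  exists x y, (x < y <= Q)%N /\ f x =1 f y.
Proof.
move=> NQ fN NM.
pose g (x : 'I_Q.+1) : {ffun 'I_n -> 'I_M.+1} := [ffun j => inord (f x j)].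
have gE x j : g x j = f x j :> nat.
  rewrite ffunE inordK// ltnS; exact: leq_trans (ltnW (fN x j)) (NM j).
have /injectivePn[x [y xy gxy]] : ~~ injectiveb g.
  apply/negP => /injectiveP ginj.
  pose F (j : 'I_n) := [pred i : 'I_M.+1 | (i < N j)%N].
  have : (#|'I_Q.+1| <= #|family F|)%N.
    rewrite -(card_codom ginj); apply/subset_leq_card/fintype.subsetP => _ /codomP[x ->].
    by apply/familyP => j; rewrite !inE gE.
  rewrite card_ord card_family => h.
  have : (foldr muln 1 [seq #|F x| | x : 'I_n] <= Q)%N.
    have -> : foldr muln 1 [seq #|F x| | x : 'I_n] =
        \prod_(i <- [seq #|F x| | x : 'I_n]) i.
      by elim: (image_mem _ _) => [|a s IH] /=; rewrite ?big_nil ?big_cons ?IH.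
    rewrite big_image /=; apply: leq_trans NQ; apply: leq_prod => j _.
    rewrite -sum1_card (eq_bigl (fun i : 'I_M.+1 => (i < N j)%N))//.
    by rewrite -(big_ord_widen M.+1 (fun=> 1%N)) ?sum1_card ?card_ord// leqW.
  by move=> h2; have := leq_trans h h2; rewrite ltnn.
have nxy : x <> y :> nat by move=> /val_inj e; rewrite e eqxx in xy.
have e j : f x j = f y j by rewrite -!gE gxy.
case: (ltngtP x y) => // h; [exists x, y|exists y, x]; split => //.
  by rewrite h -ltnS ltn_ord.
by rewrite h -ltnS ltn_ord.
Qed.

(** Dirichlet's argument on the hyperplane q.x = p.  The multiples x xi with
    0 <= x <= Q are classified by the position of their fractional parts in
    boxes of side eps_j for j <> j0, and by the residue modulo q_j0 of
    p x - sum_(j <> j0) q_j floor(x xi_j).  For two multiples in the same class,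
    with difference d, the residue condition says exactly that the integers z_j
    near d xi_j (j <> j0) extend by an integer w to a solution of q.z = p d.
    Then q_j0 (d xi_j0 - w) is determined by the other errors, and it is small
    because j0 maximises |q_j| eps_j.  Compared with the usual argument, the
    factor 1 / eps_j0 in the number of boxes is replaced by |q_j0|. *)
Lemma dirichlet_near_hyperplane (R : realType) (n Q : nat) (xi : 'rV[R]_n)
    (q : 'rV[int]_n) (p : int) (j0 : 'I_n) (eps : 'I_n -> R) :
  (forall j, 0 < eps j <= 1) -> q 0 j0 != 0 ->
  (forall j, `|(q 0 j)%:~R| * eps j <= `|(q 0 j0)%:~R| * eps j0) ->
  2 ^+ n * (`|(q 0 j0)%:~R| * eps j0) <= Q%:R * \prod_j eps j ->
  Q%:R * `|dotz q xi - p%:~R| <= eps j0 ->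
  exists d : nat, (0 < d <= Q)%N /\
    forall j, dist_int (d%:R * xi 0 j) <= n%:R * eps j.
Proof.
move=> eps01 qj0 qmax Qbig Qsmall.
have eps0 j : 0 < eps j by have /andP[] := eps01 j.
have q0 : 0 < `|(q 0 j0)%:~R| :> R by rewrite normr_gt0 intr_eq0.
(* floor(1 / eps_j) + 1 boxes are at most 2 / eps_j, since eps_j <= 1; this is
   where the factor 2 ^ n is used. *)
pose N (j : 'I_n) : nat := if j == j0 then absz (q 0 j0) else (Num.truncn (eps j)^-1).+1.
pose fl (x : nat) j := Num.floor (x%:R * xi 0 j).
pose fr (x : nat) j := x%:R * xi 0 j - (fl x j)%:~R.
pose res (x : nat) := p * x%:Z - \sum_(j | j != j0) q 0 j * fl x j.
pose f (x : nat) (j : 'I_n) : nat := if j == j0 then absz (modz (res x) (q 0 j0))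
              else Num.truncn (fr x j * (N j)%:R).
have frb x j : 0 <= fr x j < 1 := frac_bounds _.
have Ngt j : j != j0 -> 1 < (N j)%:R * eps j.
  move=> /negbTE jj; rewrite /N jj -ltr_pdivrMr// div1r.
  by have /andP[] := truncn_itv (ltW (eqbRL (invr_gt0 _) (eps0 j))).
have NQ : (\prod_j N j <= Q)%N.
  rewrite -(ler_nat R) natr_prod (bigD1 j0)//= /N eqxx.
  have -> : (absz (q 0 j0))%:R = `|(q 0 j0)%:~R| :> R.
    by rewrite -intr_norm -abszE.
  have P0 : 0 < \prod_j eps j by apply: prodr_gt0.
  rewrite -(ler_pM2r P0) (le_trans _ Qbig)// [\prod_j eps j](bigD1 j0)//= mulrACA [leRHS]mulrC.
  rewrite ler_wpM2l ?mulr_ge0 ?(ltW q0) ?(ltW (eps0 _))// -big_split /=.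
  apply: (@le_trans _ _ (\prod_(j < n | j != j0) 2)).
    apply: ler_prod => j jj; rewrite (negbTE jj) mulr_ge0 ?(ltW (eps0 _))//=.
    have /andP[a _] := truncn_itv (ltW (eqbRL (invr_gt0 _) (eps0 j))).
    have /andP[_ e1] := eps01 j; rewrite -natr1 mulrDl mul1r -[2]/(1 + 1) lerD//.
    by rewrite -ler_pdivlMr// div1r.
  rewrite prodr_const ler_weXn2l ?ler1n//.
  by rewrite (leq_trans (max_card _)) ?card_ord.
have fN x j : (f x j < N j)%N.
  rewrite /f; case: eqVneq => [->|jj].
    rewrite /N eqxx -ltz_nat gez0_abs ?modz_ge0// abszE.
    by rewrite ltz_mod.
  have /andP[a b] := frb x j.
  have N0 : 0 < (N j)%:R :> R by rewrite /N (negbTE jj) ltr0n.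
  rewrite -(ltr_nat R) (@le_lt_trans _ _ (fr x j * (N j)%:R))//.
    by have /andP[] := truncn_itv (mulr_ge0 a (ltW N0)).
  by rewrite gtr_pMl.
have [x [y [/andP[xy yQ] fxy]]] :=
  box_collision NQ fN (leq_bigmax (F := N)).
exists (y - x)%N; rewrite subn_gt0 xy leq_subLR (leq_trans yQ) ?leq_addl//; split => //.
pose d : R := (y - x)%N%:R.
have dE : d = y%:R - x%:R by rewrite /d natrB // ltnW.
pose z j := fl y j - fl x j.
have zE j : d * xi 0 j - (z j)%:~R = fr y j - fr x j.
  by rewrite dE /z /fr intrB; ring.
have close j : j != j0 -> `|d * xi 0 j - (z j)%:~R| < eps j.
  move=> jj; have := fxy j; rewrite /f (negbTE jj) => e.
  have /andP[a _] := frb x j; have /andP[b _] := frb y j.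
  by rewrite zE (same_box_lt (Ngt _ jj)).
have n1 : 1 <= n%:R :> R by rewrite ler1n (leq_ltn_trans _ (ltn_ord j0)).
move=> j; have [->|jj] := eqVneq j j0; last first.
  rewrite (le_trans (dist_int_le _ (z j)))// (le_trans (ltW (close _ jj)))//.
  by rewrite ler_peMl// ltW.
have : modz (res y) (q 0 j0) = modz (res x) (q 0 j0).
  move: (fxy j0); rewrite /f eqxx => /(congr1 Posz).
  by rewrite !gez0_abs ?modz_ge0.
move/eqP; rewrite eqz_mod_dvd => /dvdzP[w wE].
rewrite (le_trans (dist_int_le _ w))//.
have key : (q 0 j0)%:~R * (d * xi 0 j0 - w%:~R) =
    d * (dotz q xi - p%:~R) - \sum_(j | j != j0) (q 0 j)%:~R * (d * xi 0 j - (z j)%:~R).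
  move/(congr1 (fun i : int => i%:~R : R)): wE.
  rewrite /res [in X in _ = X]mulrC intrM => /esym e.
  have SE v : \sum_(j | j != j0) (q 0 j)%:~R * (fl v j)%:~R =
      (\sum_(j | j != j0) q 0 j * fl v j)%:~R :> R.
    by rewrite rmorph_sum; apply: eq_bigr => i _; rewrite /= intrM.
  have dotE : dotz q xi = (q 0 j0)%:~R * xi 0 j0 +
      \sum_(j | j != j0) (q 0 j)%:~R * xi 0 j by rewrite /dotz (bigD1 j0).
  rewrite mulrBr e dotE.
  have -> : \sum_(j | j != j0) (q 0 j)%:~R * (d * xi 0 j - (z j)%:~R) =
     d * (\sum_(j | j != j0) (q 0 j)%:~R * xi 0 j)
     - \sum_(j | j != j0) (q 0 j)%:~R * (fl y j)%:~R
     + \sum_(j | j != j0) (q 0 j)%:~R * (fl x j)%:~R :> R.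
    rewrite mulr_sumr -sumrB -big_split /=; apply: eq_bigr => i _.
    by rewrite /z intrB; ring.
  by rewrite !SE !intrB !intrM dE -!pmulrn; ring.
rewrite -(ler_pM2l q0) -normrM key (le_trans (ler_normB _ _))//.
have d0 : 0 <= d by rewrite /d ler0n.
have dQ : d <= Q%:R by rewrite /d ler_nat leq_subLR (leq_trans yQ) ?leq_addl.
apply: (@le_trans _ _ (eps j0 + \sum_(j < n | j != j0) `|(q 0 j0)%:~R| * eps j0)).
  rewrite lerD//.
    by rewrite normrM (ger0_norm d0) (le_trans _ Qsmall)// ler_wpM2r.
  rewrite (le_trans (ler_norm_sum _ _ _))//; apply: ler_sum => i ij.
  by rewrite normrM (le_trans _ (qmax i))// ler_wpM2l// ltW// close.
rewrite sumr_const -[X in _ <= _ * (X * _)]/(n%:R) mulrCA.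
have q1 : 1 <= `|(q 0 j0)%:~R| :> R.
  by rewrite -intr_norm -abszE -[1]/(1%:~R) ler_int; move: qj0; lia.
have cE : n%:R = 1 + #|[pred j | j != j0]|%:R :> R.
  have := cardC1 j0; rewrite card_ord => ->.
  by rewrite nat1r prednK// (leq_ltn_trans _ (ltn_ord j0)).
by rewrite cE mulrDl mul1r mulr_natl lerD2r ler_peMl// ltW.
Qed.

(** * Transference of exponents *)

Lemma near_le_powR (R : realType) (C b : R) :
  0 < b -> \forall t \near +oo, C <= t `^ b.
Proof.
move=> b0; near=> t.
have C0 : C <= Num.max C 0 by rewrite le_max lexx.
have M0 : 0 <= Num.max C 0 by rewrite le_max lexx orbT.
apply: le_trans C0 _.
rewrite -[leLHS]powRr1// -(mulVf (lt0r_neq0 b0)) powRrM.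
have tb : Num.max C 0 `^ b^-1 <= t by near: t; exact: nbhs_pinfty_ge.
apply: ge0_ler_powR (tb); rewrite ?nnegrE ?powR_ge0 ?(ltW b0)//.
Unshelve. all: by end_near. Qed.

(** Substituting x = t^b reduces the claim to the term x^(N+1)/(N+1)! of the
    exponential series, where N >= a/b. *)
Lemma near_powR_le_expR (R : realType) (C a b : R) :
  0 < b -> \forall t \near +oo, C * t `^ a <= expR (t `^ b).
Proof.
move=> b0.
pose N := (Num.truncn (a / b)).+1.
have aN : a / b <= N%:R.
  have [a0|a0] := leP 0 (a / b); first by have /andP[_ /ltW] := truncn_itv a0.
  exact: le_trans (ltW a0) _.
near=> t.
have t1 : 1 <= t by near: t; exact: nbhs_pinfty_ge.
have t0 : 0 < t by lra.
have x0 : 0 < t `^ b by exact: powR_gt0.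
have x1 : 1 <= t `^ b by near: t; exact: near_le_powR.
have xC : `|C| * N.+1`!%:R <= t `^ b by near: t; exact: near_le_powR.
have -> : t `^ a = (t `^ b) `^ (a / b) by rewrite -powRrM mulrC divfK// lt0r_neq0.
apply: (@le_trans _ _ (`|C| * (t `^ b) `^ N%:R)).
  apply: (@le_trans _ _ (`|C| * (t `^ b) `^ (a / b))).
    by rewrite ler_wpM2r ?powR_ge0// ler_norm.
  by rewrite ler_wpM2l// ler_powR.
apply: le_trans (expR_ge1Dxn N (ltW x0)).
rewrite powR_mulrn ?(ltW x0)// ler_wpDl// ler_pdivlMr ?ltr0n ?fact_gt0//.
by rewrite mulrAC exprS ler_wpM2r// exprn_ge0 // ltW.
Unshelve. all: by end_near. Qed.

Lemma near_pinftyP (R : realType) (P : R -> Prop) :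
  (\forall t \near +oo, P t) -> exists M, forall t, M < t -> P t.
Proof. by move=> [M [_ h]]; exists M. Qed.

Lemma weighted_norm_leP (R : realType) (n : nat) (s x : 'rV[R]_n) (a : R) :
  (forall j, 0 < s 0 j) -> 0 <= a ->
  weighted_norm s x <= a <-> forall j, `|x 0 j| <= a `^ s 0 j.
Proof.
move=> s0 a0; have h j : (`|x 0 j| `^ (s 0 j)^-1 <= a) = (`|x 0 j| <= a `^ s 0 j).
  have e : (`|x 0 j| `^ (s 0 j)^-1) `^ (s 0 j) = `|x 0 j|.
    by rewrite -powRrM mulVf ?powRr1// lt0r_neq0.
  apply/idP/idP => xa.
    by rewrite -e ge0_ler_powR// ?ltW// nnegrE ?powR_ge0.
  have : `|x 0 j| `^ (s 0 j)^-1 <= (a `^ s 0 j) `^ (s 0 j)^-1.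
    by rewrite ge0_ler_powR// ?invr_ge0 ?ltW// nnegrE ?powR_ge0.
  by rewrite -powRrM mulfV ?powRr1// lt0r_neq0.
split=> [xa j|xa].
  rewrite -h; apply: le_trans xa; exact: (le_bigmax_cond _ (fun j => `|x 0 j| `^ (s 0 j)^-1)).
by apply: bigmax_le => // j _; rewrite h.
Qed.

Lemma min_weight_bounds (R : realType) (n : nat) (s : 'rV[R]_n) :
  (0 < n)%N -> weights s ->
  [/\ 0 < min_weight s, min_weight s < 1 & forall j, min_weight s <= s 0 j].
Proof.
move=> n0 [s01 _]; have le j : min_weight s <= s 0 j by exact: bigmin_le_cond.
split => //.
  by apply: lt_bigmin => // j _; have /andP[] := s01 j.
by apply: (le_lt_trans (le (Ordinal n0))); have /andP[] := s01 (Ordinal n0).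
Qed.

(** Fix c = n g < 1/(1 - del), with del the least weight, and use the
    approximating q of weighted norm at most tau = t^(c eta), eta small.  With
    eps_j of order t^(-c s_j), the number of boxes is of order
    t^c |q_j0| eps_j0, and |q_j0| eps_j0 <= t^(-c (1 - eta) s_j0) is at most
    t^(-c (1 - eta) del).  The exponent c - c (1 - eta) del is less than 1 for
    eta small, so t multiples of xi suffice.  The error of q is of order
    exp(-tau), smaller than any power of t. *)
Lemma weighted_transference (R : realType) (n : nat) (s xi : 'rV[R]_n) :
  (0 < n)%N -> weights s ->
  (\forall t \near +oo, exists q : 'rV[int]_n,
     [/\ q != 0, weighted_norm s (map_mx intr q) <= t &
         dist_int (dotz q xi) <= expR (- t)]) ->
  (((n%:R * (1 - min_weight s))^-1)%:E <= weighted_omega_hat s xi)%E.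
Proof.
move=> n0 ws /near_pinftyP[M HM].
have [del0 del1 dels] := min_weight_bounds n0 ws.
have [s01 ssum] := ws.
have s0 j : 0 < s 0 j by have /andP[] := s01 j.
set del := min_weight s in del0 del1 dels *.
have nR : 1 <= n%:R :> R by rewrite ler1n.
have nd0 : 0 < n%:R * (1 - del) by rewrite mulr_gt0 ?ltr0n// subr_gt0.
suff H g : 0 < g < (n%:R * (1 - del))^-1 -> (g%:E <= weighted_omega_hat s xi)%E.
  apply/lee_addgt0Pr => e e0.
  have [eg|eg] := leP (n%:R * (1 - del))^-1 e.
    apply: (@le_trans _ _ e%:E); first by rewrite lee_fin.
    rewrite leeDr//; pose h := (n%:R * (1 - del))^-1 / 2.
    apply: (@le_trans _ _ h%:E); first by rewrite lee_fin divr_ge0// invr_ge0 ltW.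
    apply: H; have : 0 < (n%:R * (1 - del))^-1 by rewrite invr_gt0.
    by rewrite /h; lra.
  rewrite -leeBlDr//; rewrite -EFinB; apply: H; lra.
move=> /andP[g0 gub].
pose c := n%:R * g.
have c0 : 0 < c by rewrite mulr_gt0// ltr0n.
have c1 : c * (1 - del) < 1.
  by move: gub; rewrite -[ltRHS]div1r ltr_pdivlMr// /c; nra.
pose k := 1 - c * (1 - del).
have k0 : 0 < k by rewrite subr_gt0.
pose eta := Num.min (1 / 2) (k / (2 * c)).
have eta0 : 0 < eta by rewrite lt_min divr_gt0//= divr_gt0// mulr_gt0.
have eta1 : eta <= 1 / 2 by rewrite ge_min lexx.
have etak : c * eta <= k / 2.
  have : eta <= k / (2 * c) by rewrite ge_min lexx orbT.
  by rewrite ler_pdivlMr ?mulr_gt0//; nra.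
(* sg > 0 is the margin that absorbs all constants when t is large. *)
pose sg := 1 - c + c * (1 - eta) * del.
have sg0 : 0 < sg by rewrite /sg; move: etak; rewrite /k; nra.
have ceta0 : 0 < c * eta by rewrite mulr_gt0.
apply: ereal_sup_ubound; exists g => //=.
near=> t.
have t1 : 1 <= t by near: t; exact: nbhs_pinfty_ge.
have t0 : 0 < t by lra.
pose tau := t `^ (c * eta).
have tau1 : 1 <= tau by rewrite /tau; near: t; exact: near_le_powR.
have [|q [qn0 qtau qxi]] := HM tau.
  apply: (@lt_le_trans _ _ (M + 1)); first by rewrite ltrDl.
  by rewrite /tau; near: t; exact: near_le_powR.
have /weighted_norm_leP-/(_ s0 (le_trans ler01 tau1)) qs := qtau.
pose eps (j : 'I_n) := n%:R^-1 * t `^ (- (c * s 0 j)).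
have epsE j : n%:R * eps j = t `^ (- (c * s 0 j)).
  by rewrite /eps mulVKf// pnatr_eq0 -lt0n.
have eps0 j : 0 < eps j by rewrite mulr_gt0 ?invr_gt0 ?ltr0n// powR_gt0.
have tpow1 (a : R) : 0 <= a -> t `^ (- a) <= 1.
  by move=> a0; rewrite -(powRr0 t) ler_powR// oppr_le0.
have eps1 j : eps j <= 1.
  rewrite mulr_ile1 ?invr_ge0 ?powR_ge0// ?invf_le1 ?ltr0n//.
  by rewrite tpow1// mulr_ge0// ltW.
have [j1 qj1] : exists j, q 0 j != 0.
  apply/existsP; apply: contra_neqT qn0; rewrite negb_exists => /forallP h.
  by apply/rowP => j; rewrite mxE; apply/eqP; have := h j; rewrite negbK.
pose F j := `|(q 0 j)%:~R| * eps j.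
have [j0 _ jmax] := @arg_maxP _ _ _ j1 xpredT F isT.
have qj0 : q 0 j0 != 0.
  apply/eqP => e; have : F j1 <= F j0 := jmax j1 isT.
  by rewrite /F e normr0 mul0r leNgt mulr_gt0// normr_gt0 intr_eq0.
have [p pq] : exists p : int, `|dotz q xi - p%:~R| < 2 * expR (- tau).
  apply: dist_int_near; rewrite (le_lt_trans qxi)//.
  by have := expR_gt0 (- tau); lra.
pose Q := Num.truncn t.
have /andP[Qt tQ] : Q%:R <= t < Q.+1%:R by rewrite truncn_itv// ltW.
have Q2 : t / 2 <= Q%:R.
  have : 1 <= Q%:R :> R.
    by rewrite ler1n -(ltr_nat R) ltNge; apply/negP => h; move: tQ; rewrite -natr1; lra.
  by move: tQ; rewrite -natr1; lra.
have [|||d [/andP[d0 dQ] dxi]] :=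
  @dirichlet_near_hyperplane R n Q xi q p j0 eps _ qj0 (fun j => jmax j isT).
- by move=> j; rewrite eps0 eps1.
- have -> : \prod_j eps j = n%:R^-1 ^+ n * t `^ (- c).
    rewrite big_split /= prodr_const card_ord; congr (_ * _).
    have -> : - c = \sum_j - (c * s 0 j) by rewrite sumrN -mulr_sumr ssum mulr1.
    elim/big_ind2 : _ => [|x y z w -> ->|//]; first by rewrite powRr0.
    by rewrite powRD// lt0r_neq0 ?implybT.
  apply: (@le_trans _ _ (2 ^+ n * t `^ (- (c * (1 - eta) * del)))).
    rewrite ler_wpM2l ?exprn_ge0//.
    apply: (@le_trans _ _ (tau `^ s 0 j0 * t `^ (- (c * s 0 j0)))).
      apply: ler_pM; [exact: normr_ge0|exact: ltW| |].
        by have := qs j0; rewrite mxE.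
      by rewrite ler_piMl ?powR_ge0// invf_le1// ltr0n.
    rewrite /tau -powRrM -powRD ?(lt0r_neq0 t0) ?implybT// ler_powR//.
    have : 0 <= c * (1 - eta) * (s 0 j0 - del).
      by rewrite !mulr_ge0 ?subr_ge0// ?(ltW c0)//; lra.
    by lra.
  apply: (@le_trans _ _ (t / 2 * (n%:R^-1 ^+ n * t `^ (- c)))); last first.
    by rewrite ler_wpM2r// mulr_ge0 ?powR_ge0// exprn_ge0// invr_ge0.
  have big : 2 ^+ n * 2 * n%:R ^+ n <= t `^ sg by near: t; exact: near_le_powR.
  have nn0 : 0 < n%:R ^+ n :> R by rewrite exprn_gt0// ltr0n.
  have -> : t / 2 * (n%:R^-1 ^+ n * t `^ (- c)) =
      t `^ sg / (2 * n%:R ^+ n) * t `^ (- (c * (1 - eta) * del)).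
    have -> : sg = 1 + - c + c * (1 - eta) * del by [].
    have tn0 : t != 0 by rewrite gt_eqF.
    rewrite !powRD ?tn0 ?implybT// powRr1 ?(ltW t0)// exprVn [t `^ (- (_ * del))]powRN.
    field; rewrite (gt_eqF nn0) gt_eqF ?powR_gt0//.
  by rewrite ler_wpM2r ?powR_ge0// ler_pdivlMr ?mulr_gt0// mulrA.
- apply: (@le_trans _ _ (t * (2 * expR (- tau)))).
    by rewrite ler_pM// ltW.
  have big : 2 * n%:R * t `^ (1 + c) <= expR tau.
    by rewrite /tau; near: t; exact: near_powR_le_expR.
  have nn0 : 0 < n%:R :> R by rewrite ltr0n.
  apply: (@le_trans _ _ (n%:R^-1 * t `^ (- c))); last first.
    rewrite ler_wpM2l ?invr_ge0// ler_powR// lerN2 ler_piMr// ?ltW//.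
    by have /andP[] := s01 j0.
  rewrite !powRN expRN powRD in big *; last by rewrite (gt_eqF t0) implybT.
  rewrite powRr1 ?(ltW t0)// in big.
  have tc0 : 0 < t `^ c by exact: powR_gt0.
  rewrite -invfM -[leRHS]div1r ler_pdivlMr ?mulr_gt0//.
  rewrite [leLHS](_ : _ = 2 * n%:R * (t * t `^ c) / expR tau); last by ring.
  by rewrite ler_pdivrMr ?expR_gt0// mul1r.
exists (d%:Z); split.
- by rewrite ltz_nat.
- by rewrite (le_trans _ Qt)// -pmulrn ler_nat.
- apply/weighted_norm_leP => //; first exact: powR_ge0.
  move=> j; rewrite !mxE ger0_norm ?dist_int_ge0// -powRrM -pmulrn.
  by rewrite mulNr -epsE; exact: dxi.
Unshelve. all: by end_near. Qed.

(** * Singular points from a Khintchine system *)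

Lemma rV_coord_le_norm (R : realType) (n : nat) (x : 'rV[R]_n) j : `|x 0 j| <= `|x|.
Proof.
by rewrite [leRHS]/Num.norm /= mx_normrE; apply/bigmax_geP; right => /=; exists (0, j).
Qed.

Lemma dotz_cvg (R : realType) (n : nat) (q : 'rV[int]_n) (x : 'rV[R]_n) :
  dotz q y @[y --> x] --> dotz q x.
Proof.
rewrite /dotz; elim: (index_enum _) => [|j r IH].
  rewrite big_nil (_ : (fun y => _) = cst 0); first exact: (@cvg_cst _ (0 : R) _ (nbhs x) _).
  by apply/funext => y; rewrite big_nil.
rewrite big_cons (_ : (fun y => _) = fun y : 'rV[R]_n =>
  (q 0 j)%:~R * y 0 j + \sum_(i <- r) (q 0 i)%:~R * y 0 i).
  apply: (@cvgD R R^o _ (nbhs x) _); last exact: IH.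
  by apply: (@cvgM R _ (nbhs x) _); [exact: (@cvg_cst _ _ _ (nbhs x) _)|exact: coord_continuous].
by apply/funext => y; rewrite big_cons.
Qed.

Lemma hyperplane_closed (R : realType) (n : nat) (m : 'rV[int]_n.+1) :
  closed (@hyperplane R n m).
Proof.
rewrite (_ : hyperplane m = dotz (normal_part m) @^-1` [set (m 0 ord0)%:~R])//.
apply: preimage_closed; first by move=> x _; exact: dotz_cvg.
exact: closed_eq.
Qed.

Lemma closed_ball_rV_compact (R : realType) (n : nat) (x : 'rV[R]_n) (r : R) :
  compact [set z | `|z - x| <= r].
Proof.
apply: bounded_closed_compact.
  exists (`|x| + r); split; first exact: num_real.
  move=> M Mr z /= zx; rewrite -[z](subrK x).
  by rewrite (le_trans (ler_normD _ _))// addrC (le_trans _ (ltW Mr))// lerD2l.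
rewrite (_ : mkset _ = closed_ball_ Num.norm x r); first exact: closed_closed_ball_.
by apply/seteqP; split => z /=; rewrite distrC.
Qed.

(** A rational relation is made integral by a common denominator, then
    primitive by dividing by the gcd. *)
Lemma totally_irrational_avoids (R : realType) (n : nat) (xi : 'rV[R]_n) :
  totally_irrational xi <-> ~ in_rational_hyperplane [set xi].
Proof.
split=> [irr [m [_ m0] /(_ xi erefl) mxi]|out c a rel].
  pose a : 'rV[rat]_n := map_mx intr (normal_part m).
  have mxi' : dotz (normal_part m) xi = (m 0 ord0)%:~R := mxi.
  have [|_ a0] := irr (- (m 0 ord0)%:~R) a.
    rewrite rmorphN /= ratr_int -mxi' addrC; apply/eqP; rewrite subr_eq0; apply/eqP.
    by apply: eq_bigr => j _; rewrite !mxE ratr_int.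
  move/eqP: m0; apply; apply/rowP => j.
  move/rowP: a0 => /(_ j); rewrite !mxE => /eqP.
  by rewrite intr_eq0 => /eqP.
have [a0|an0] := eqVneq a 0.
  split=> //; move: rel; rewrite a0 big1 => [|j _]; last by rewrite mxE rmorph0 mul0r.
  by rewrite addr0 => /eqP; rewrite fmorph_eq0 => /eqP.
exfalso; apply: out.
pose D : int := denq c * \prod_j denq (a 0 j).
have D0 : D != 0.
  by rewrite mulf_neq0 ?denq_neq0//; apply/prodf_neq0 => j _; exact: denq_neq0.
have [k0 k0E] : exists k : int, c * D%:~R = k%:~R.
  exists (numq c * \prod_j denq (a 0 j)).
  by rewrite /D !intrM mulrA numqE.
have [k kE] : exists k : 'rV[int]_n, forall j, a 0 j * D%:~R = (k 0 j)%:~R.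
  exists (\row_j (numq (a 0 j) * (denq c * \prod_(i | i != j) denq (a 0 i)))) => j.
  by rewrite mxE /D (bigD1 j)//= mulrCA !intrM numqE !mulrA.
pose M : 'rV[int]_n.+1 := \row_i (if unlift ord0 i is Some j then k 0 j else - k0).
have M0 : M 0 ord0 = - k0 by rewrite mxE unlift_none.
have MS j : M 0 (lift ord0 j) = k 0 j by rewrite mxE liftK.
pose G := \big[gcdn/0%N]_(i < n.+1) absz (M 0 i).
have GM i : dvdn G (absz (M 0 i)) by exact: (biggcdn_inf i).
have [j kj0] : exists j, k 0 j != 0.
  apply/existsP; apply: contra_neqT an0; rewrite negb_exists => /forallP h.
  apply/rowP => j; rewrite mxE; have := h j; rewrite negbK => /eqP kj.
  apply/eqP; have /eqP := kE j; rewrite kj mulf_eq0 intr_eq0 (negbTE D0) orbF.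
  by [].
have G0 : (0 < G)%N.
  by rewrite lt0n; apply/eqP => G0; have := GM (lift ord0 j); rewrite MS G0 dvd0n absz_eq0 (negbTE kj0).
pose m : 'rV[int]_n.+1 := \row_i divz (M 0 i) G%:Z.
have mE i : m 0 i * G%:Z = M 0 i.
  by rewrite mxE; apply: divzK; exact: GM.
exists m; first split.
- apply/eqP; rewrite -dvdn1 -(dvdn_pmul2r G0) mul1n {2}/G.
  apply/dvdn_biggcdP => i _; rewrite -mE abszM dvdn_mul//.
  exact: (biggcdn_inf i).
- apply: contra_neq kj0 => /rowP/(_ j); rewrite -MS -mE mxE [RHS]mxE => ->.
  by rewrite mul0r.
- move=> _ ->; rewrite /hyperplane /=.
  have GR : G%:Z%:~R != 0 :> R by rewrite intr_eq0 -lt0n.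
  apply: (mulIf GR); rewrite -intrM mE M0 /dotz mulr_suml.
  have -> : (- k0)%:~R = - (ratr c * (D%:~R)) :> R.
    by rewrite -[X in - (_ * X)]ratr_int -rmorphM /= k0E ratr_int intrN.
  move/eqP: rel; rewrite addrC addr_eq0 => /eqP rel.
  rewrite -mulNr -rel mulr_suml; apply: eq_bigr => i _.
  rewrite [normal_part m 0 i]mxE mulrAC -intrM mE MS.
  rewrite -[(k 0 i)%:~R]ratr_int -kE rmorphM /= ratr_int; ring.
Qed.

Lemma finite_set_bounded (R : realType) (T : choiceType) (A : set T) (f : T -> R) :
  finite_set A -> exists M, forall x, A x -> f x <= M.
Proof.
move=> /finite_seqP[s ->]; elim: s => [|y s [M IH]]; first by exists 0.
exists (Num.max (f y) M) => x /=; rewrite inE le_max => /predU1P[->|xs].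
  by rewrite lexx.
by rewrite IH ?orbT.
Qed.

Lemma near_rel_closed (R : realType) (n : nat) (S Z : set 'rV[R]_n) x :
  rel_closed S Z -> S x -> ~ Z x -> \forall z \near x, S z -> ~ Z z.
Proof.
move=> [C Ccl ->] Sx nZ.
have nC : (~` C) x by move=> Cx; exact: nZ.
have : nbhs x (~` C) by exact: open_nbhs_nbhs (conj (closed_openC Ccl) nC).
by apply: filterS => z nCz Sz [_ Cz].
Qed.

Section singular_points.
Context (R : realType) (n : nat) (S : set 'rV[R]_n) (I J : set nat)
  (L L' : nat -> set 'rV[R]_n) (m : nat -> 'rV[int]_n.+1).
Hypothesis KS : Khintchine_system S I J L L' m.

Lemma Khintchine_dense_crossing i x T (r : R) :
  I i -> L i x -> 0 < T -> 0 < r ->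
  exists j y, [/\ I j, T < height R (m j), L i y, L j y & `|y - x| < r].
Proof.
move=> Ii Lx T0 r0; have : rel_closure S (\bigcup_(j in [set j | I j /\
  T < height R (m j)]) (L i `&` L j)) x by rewrite -(Khintchine_b KS Ii T0).
move=> [_ /(_ (ball x r))]; case; first exact: nbhsx_ballx.
move=> y [[j [Ij hj] [Liy Ljy]]]; rewrite -ball_normE /= distrC => xy.
by exists j, y; split.
Qed.

(** Condition (c) moves a point of L_j off any finite number of other members; these
    being closed, the new point has a whole neighbourhood off them. *)
Lemma Khintchine_escape j y nu (O : set 'rV[R]_n) :
  I j -> L j y -> nbhs y O ->
  exists x, [/\ L j x, nbhs x O &
    \forall z \near x, S z -> forall k : nat, (k <= nu)%N ->
      (I k -> k <> j -> ~ L k z) /\ (J k -> ~ L' k z)].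
Proof.
move=> Ij Ljy Oy.
pose F := [set k | (k <= nu)%N /\ I k /\ k <> j].
pose F' := [set k | (k <= nu)%N /\ J k].
have fin (A : set nat) : A `<=` [set k | (k <= nu)%N] -> finite_set A.
  move=> sub; apply: (sub_finite_set _ (finite_II nu.+1)) => k /sub /=.
  by rewrite ltnS.
have FI : F `<=` I by move=> k [_ []].
have FJ : F' `<=` J by move=> k [].
have finF : finite_set F by apply: fin => k [].
have finF' : finite_set F' by apply: fin => k [].
have nFj : ~ F j by move=> [_ []].
have [Sy cl] : rel_closure S
    (L j `\` (\bigcup_(k in F) L k `|` \bigcup_(k in F') L' k)) y.
  by rewrite -(Khintchine_c KS Ij finF finF' FI FJ nFj).
have [x [[Ljx avoid] Ox]] := cl _ (nbhs_interior Oy).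
have Sx : S x by have [C _ e] := Khintchine_closed KS Ij; move: Ljx; rewrite e => -[].
exists x; split => //.
pose G (k : 'I_nu.+1) z :=
  S z -> (I k -> k <> j :> nat -> ~ L k z) /\ (J k -> ~ L' k z).
have : \forall z \near x, forall k, G k z.
  apply: (@filter_forall _ _ G (nbhs x)) => k.
  have A1 : \forall z \near x, S z -> I k -> k <> j :> nat -> ~ L k z.
    have [[Ik kj]|h] := pselect (I k /\ k <> j :> nat); last first.
      by apply: (@nearW _ (nbhs x)) => z _ Ik kj; exfalso; apply: h.
    have : ~ L k x.
      move=> Lkx; apply: avoid; left; exists (k : nat) => //.
      by split; [rewrite -ltnS|].
    move/(near_rel_closed (Khintchine_closed KS Ik) Sx).
    by apply: filterS => z h Sz _ _; exact: h.
  have A2 : \forall z \near x, S z -> J k -> ~ L' k z.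
    have [Jk|h] := pselect (J k); last by apply: (@nearW _ (nbhs x)) => z _ Jk; exfalso; apply: h.
    have : ~ L' k x.
      move=> Lkx; apply: avoid; right; exists (k : nat) => //.
      by split; [rewrite -ltnS|].
    move/(near_rel_closed (Khintchine_closed' KS Jk) Sx).
    by apply: filterS => z h Sz _; exact: h.
  by apply: filterS2 A1 A2 => z h1 h2 Sz; split; [exact: h1|exact: h2].
apply: filterS => z h Sz k knu.
by have := h (Ordinal (knu : (k < nu.+1)%N)) Sz.
Qed.

Variables (Phi : 'rV[int]_n -> R) (phi : R -> R).
Hypothesis Phi_gt0 : forall q, q != 0 -> 0 < Phi q.
Hypothesis Phi_finite : forall C : R, 0 < C -> finite_set [set q | q != 0 /\ Phi q <= C].
Hypothesis phi_gt0 : forall t, 0 < t -> 0 < phi t.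
Hypothesis phi_nincr : forall t t', 0 < t -> t <= t' -> phi t' <= phi t.
Variables (E : set 'rV[R]_n) (e : 'rV[R]_n -> nat).
Hypothesis E_inj : {in E &, injective e}.
Hypothesis E_out : forall x, E x -> ~ in_rational_hyperplane [set x].

Let q i := normal_part (m i).

Let q_neq0 i : I i -> q i != 0.
Proof. by move=> /(Khintchine_hyperplane KS)[[_ h] _]. Qed.

(** One step of Khintchine's construction, from a ball about a point of L_i to a
    ball about a point of L_j.  On the new ball the form of A_i is within
    phi(Phi(q_j)) of an integer, which makes it a good form for every t with
    Phi(q_i) <= t < Phi(q_j), as phi is non-increasing.  The exception k <> j is
    harmless: the following step moves to an index other than j, and avoids
    L_j. *)
Definition singular_step nu i x (r : R) j x' (r' : R) : Prop :=
  [/\ Phi (q i) + 1 <= Phi (q j), 0 < r',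
      forall z, `|z - x'| <= r' -> `|z - x| < r /\ dist_int (dotz (q i) z) <= phi (Phi (q j)) &
      forall z, `|z - x'| <= r' -> S z ->
        ~ (E z /\ e z = nu) /\ forall k : nat, (k <= nu)%N ->
          (I k -> k <> j -> ~ L k z) /\ (J k -> ~ L' k z)].

(** Only finitely many q have Phi(q) <= Phi(q_i) + 1, hence a crossing of L_i
    with a member of large enough height also increases Phi by at least 1. *)
Lemma singular_step_exists nu i x (r : R) :
  I i -> L i x -> 0 < r ->
  exists j x' r', [/\ I j, L j x' & singular_step nu i x r j x' r'].
Proof.
move=> Ii Lix r0.
have Phii : 0 < Phi (q i) + 1 by rewrite ltr_wpDl// ltW// Phi_gt0// q_neq0.
have [T0 T0P] := finite_set_bounded (@znorm R n) (Phi_finite Phii).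
have T1 : 0 < Num.max T0 1 by rewrite lt_max ltr01 orbT.
have [j [y [Ij hj Liy Ljy yx]]] :=
  Khintchine_dense_crossing Ii Lix T1 r0.
have Phij : Phi (q i) + 1 <= Phi (q j).
  rewrite leNgt; apply/negP => h; have := T0P (q j) (conj (q_neq0 Ij) (ltW h)).
  rewrite leNgt => /negP; apply; apply: le_lt_trans hj.
  by rewrite le_max lexx.
have Phij0 : 0 < Phi (q j) by rewrite Phi_gt0// q_neq0.
have yhyp : dotz (q i) y = (m i 0 ord0)%:~R.
  by have [_ h] := Khintchine_hyperplane KS Ii; exact: h.
pose O := [set z | `|z - x| < r /\ dist_int (dotz (q i) z) <= phi (Phi (q j))].
have Oy : nbhs y O.
  have A1 : \forall z \near y, `|z - x| < r.
    have : nbhs y (ball x r).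
      by apply: open_nbhs_nbhs; split; [exact: ball_open|rewrite -ball_normE /= distrC].
    by apply: filterS => z; rewrite -ball_normE /= distrC.
  have A2 : \forall z \near y, `|dotz (q i) y - dotz (q i) z| < phi (Phi (q j)).
    by have /cvgrPdist_lt/(_ _ (phi_gt0 Phij0)) := @dotz_cvg R n (q i) y.
  apply: filterS2 A1 A2 => z h1 h2; split => //.
  by rewrite (le_trans (dist_int_le _ (m i 0 ord0)))// -yhyp distrC ltW.
have [x' [Ljx' Ox' avoid]] := Khintchine_escape nu Ij Ljy Oy.
have [_ Ljhyp] := Khintchine_hyperplane KS Ij.
have A3 : \forall z \near x', ~ (E z /\ e z = nu).
  have [[w [Ew ew]]|no] := pselect (exists w, E w /\ e w = nu); last first.
    by apply: (@nearW _ (nbhs x')) => z h; apply: no; exists z.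
  have wx' : x' != w.
    apply/eqP => x'w; apply: (E_out Ew); exists (m j); last by rewrite -x'w => _ ->; exact: Ljhyp.
    by have [] := Khintchine_hyperplane KS Ij.
  have : \forall z \near x', z != w.
    apply/nbhs_ballP; exists `|x' - w| => /=; first by rewrite normr_gt0 subr_eq0.
    move=> z; rewrite -ball_normE /= => h; apply/eqP => zw.
    by rewrite zw ltxx in h.
  apply: filterS => z /eqP zw [Ez ez]; apply: zw; apply: E_inj; rewrite ?inE//.
  by rewrite ez ew.
have : nbhs x' (O `&` [set z | S z -> ~ (E z /\ e z = nu) /\ forall k : nat, (k <= nu)%N ->
          (I k -> k <> j -> ~ L k z) /\ (J k -> ~ L' k z)]).
  apply: filterI => //; apply: filterS2 A3 avoid => z h1 h2 Sz; split => //.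
  by move=> k; exact: h2.
move=> /nbhs_ballP[r1 /= r10 sub].
have inb z : `|z - x'| <= r1 / 2 -> ball x' r1 z.
  by rewrite -ball_normE /= distrC => h; apply: (le_lt_trans h); lra.
exists j, x', (r1 / 2); split => //; split => //.
- by rewrite divr_gt0.
- by move=> z /inb/sub[].
- by move=> z /inb/sub[].
Qed.

(** The point is a cluster point of the centres: by compactness of the first ball
    there is one, and it lies in all the balls.  It lies in S because S is
    locally closed and the first ball is inside the open set that witnesses
    it. *)
Lemma singular_point_exists :
  locally_closed S -> S !=set0 ->
  exists xi, [/\ S xi, totally_irrational xi, ~ E xi &
    \forall t \near +oo, exists q, [/\ q != 0, Phi q <= t & dist_int (dotz q xi) <= phi t]].
Proof.
move=> [W Wop SE] [s0 Ss0].
have Ws0 : W s0 by move: Ss0; rewrite SE => -[].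
have [x0 [[i0 Ii0 Lx0] Wx0]] : (\bigcup_(i in I) L i) `&` W !=set0.
  have : rel_closure S (\bigcup_(i in I) L i) s0 by rewrite (Khintchine_d KS).
  by move=> [_]; apply; exact: open_nbhs_nbhs.
have : nbhs x0 W by exact: open_nbhs_nbhs.
move=> /nbhs_ballP[r0 /= r00 r0W].
pose st : Type := nat * (nat * 'rV[R]_n * R).
pose good (u : st) := [/\ I u.2.1.1, L u.2.1.1 u.2.1.2 & 0 < u.2.2].
pose rel (u v : {u : st | good u}) := let u := sval u in let v := sval v in
  v.1 = u.1.+1 /\ singular_step u.1 u.2.1.1 u.2.1.2 u.2.2 v.2.1.1 v.2.1.2 v.2.2.
have total u : {v | rel u v}.
  case: u => -[nu [[i x] r]] gu; apply: cid; case: (gu) => /= Ii Lx r0'.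
  have [j [x' [r' [Ij Lj st']]]] := singular_step_exists nu Ii Lx r0'.
  have gv : good (nu.+1, (j, x', r')) by split => //; have [] := st'.
  by exists (exist _ _ gv).
have g0 : good (0%N, (i0, x0, r0)) by split.
have [u [u0 urel]] := dependent_choice total (exist _ _ g0).
pose ii nu := (sval (u nu)).2.1.1; pose xx nu := (sval (u nu)).2.1.2.
pose rr nu := (sval (u nu)).2.2.
have u1 nu : (sval (u nu)).1 = nu.
  by elim: nu => [|nu IH]; [rewrite u0|have [-> _] := urel nu; rewrite IH].
have Iii nu : I (ii nu) by have [] := svalP (u nu).
have Lxx nu : L (ii nu) (xx nu) by have [] := svalP (u nu).
have rr0 nu : 0 < rr nu by have [] := svalP (u nu).
have step nu : singular_step nu (ii nu) (xx nu) (rr nu) (ii nu.+1) (xx nu.+1) (rr nu.+1).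
  by have [_] := urel nu; rewrite u1.
have sub1 nu z : `|z - xx nu.+1| <= rr nu.+1 -> `|z - xx nu| <= rr nu.
  by have [_ _ h _] := step nu => /h[/ltW].
have nest nu mu : (nu <= mu)%N -> forall z, `|z - xx mu| <= rr mu -> `|z - xx nu| <= rr nu.
  move=> /subnKC <-; elim: (mu - nu)%N => [|d IH] z; first by rewrite addn0.
  by rewrite addnS => /sub1/IH.
have Sxx nu : S (xx nu).
  have [C _ h] := Khintchine_closed KS (Iii nu).
  by have := Lxx nu; rewrite h => -[].
have near_in nu : \forall mu \near \oo, `|xx mu - xx nu| <= rr nu.
  by exists nu => // mu /= h; apply: (nest _ _ h); rewrite subrr normr0 ltW.
have [xi [_ xicl]] : [set z | `|z - xx 0%N| <= rr 0%N] `&` cluster (xx @ \oo) !=set0.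
  by apply: closed_ball_rV_compact; exact: near_in.
have xin nu : `|xi - xx nu| <= rr nu.
  have : closed [set z | `|z - xx nu| <= rr nu].
    exact: compact_closed (@norm_hausdorff _ _) (@closed_ball_rV_compact _ _ _ _).
  by apply => B Bxi; exact: xicl (near_in nu) Bxi.
have Wxi : W xi.
  apply: r0W; rewrite -ball_normE /= distrC.
  have [_ _ h _] := step 0%N; have [] := h _ (xin 1%N).
  by rewrite /xx /rr u0.
have Sxi : S xi.
  rewrite SE; split => // B Bxi; apply: xicl => //.
  by exists 0%N => // mu _; exact: Sxx.
pose P nu := Phi (q (ii nu)).
have PS nu : P nu + 1 <= P nu.+1 by have [] := step nu.
have iiS nu : ii nu.+1 <> ii nu.
  by move=> h; have := PS nu; rewrite /P h gerDl ler10.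
have av nu := let: And4 _ _ _ h := step nu in h _ (xin nu.+1) Sxi.
have irr : totally_irrational xi.
  apply/totally_irrational_avoids => hyp.
  have : (\bigcup_(i in I) L i `|` \bigcup_(j in J) L' j) xi by rewrite (Khintchine_a KS).
  move=> [[k Ik Lk]|[k Jk Lk]]; last by have [_ /(_ k (leqnn k))[_ /(_ Jk)]] := av k.
  have [_ /(_ k (leqnn k))[h _]] := av k.
  (* The step k avoids L_k unless it moves to index k; then the next one does. *)
  have [kj|kj] := pselect (k = ii k.+1); last exact: h kj Lk.
  have [_ /(_ k (leqnSn k))[h' _]] := av k.+1.
  by apply: h' Lk => //; rewrite {1}kj => /esym; exact: iiS.
exists xi; split => //.
  move=> Exi; have [h _] := av (e xi); exact: h.
have Pge nu : P 0%N + nu%:R <= P nu.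
  elim: nu => [|nu IH]; first by rewrite addr0.
  by apply: le_trans (PS nu); rewrite -natr1 addrA lerD2r.
near=> t.
have tP0 : P 0%N <= t by near: t; apply: nbhs_pinfty_ge; exact: num_real.
(* The form in charge at t is the last one whose Phi is at most t. *)
have [nu Pnu Pnu1] : exists2 nu, P nu <= t & t < P nu.+1.
  have ex : exists nu, t < P nu.
    exists (Num.truncn (t - P 0%N)).+1; apply: lt_le_trans (Pge _).
    by rewrite -ltrBlDl; have /andP[] := truncn_itv (eqbRL (subr_ge0 _ _) tP0).
  case: (ex_minnP ex) => -[|nu] tnu numin; first by rewrite ltNge tP0 in tnu.
  exists nu => //; rewrite leNgt; apply/negP => /numin; by rewrite ltnn.
exists (q (ii nu)); split => //; first exact: q_neq0.
have [_ _ h _] := step nu; have [_ le] := h _ (xin nu.+1).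
apply: (le_trans le); apply: phi_nincr; last exact: ltW.
by apply: lt_le_trans Pnu; rewrite Phi_gt0// q_neq0.
Unshelve. all: by end_near. Qed.

End singular_points.

(** * Jets of analytic functions *)

Section jets.
Context (R : realType) (k : nat).
Implicit Types (U : set 'rV[R]_k) (G : seq 'I_k -> 'rV[R]_k -> R).

Definition jet_term G (x y : 'rV[R]_k) (a : {ffun 'I_k -> nat}) : R :=
  G (index_seq a) x / (\prod_(j < k) (a j)`!)%:R
    * \prod_(j < k) (y 0 j - x 0 j) ^+ a j.

(** The family of all iterated partial derivatives of an analytic function,
    indexed by the sequence of differentiation directions.  Carrying the whole
    family makes linear combinations immediate: their derivatives are the
    corresponding combinations, with no appeal to locality of derivatives. *)
Record analytic_jet U G : Prop := {
  jet_differentiable : forall s x, U x -> differentiable (G s) x;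
  jet_derive : forall s j x, U x -> 'D_('e_j) (G s) x = G (j :: s) x;
  jet_taylor : forall x, U x -> \forall y \near x,
    summability.partial_sum (jet_term G x y) @ summability.totally --> G [::] y }.

Lemma pderivs_jet U (g : 'rV[R]_k -> R) :
  real_analytic_on U g -> analytic_jet U (fun s => pderivs s g).
Proof. by move=> [sm ta]; split => // s x Ux; exact: sm. Qed.

(** Unconditional sums are linear; the constant contributes the single term of
    the zero multi-index. *)
Lemma lin_comb_jet n U (G : 'I_n -> seq 'I_k -> 'rV[R]_k -> R) (a : 'I_n -> R) (c : R) :
  (forall i, analytic_jet U (G i)) ->
  analytic_jet U (fun s x => \sum_i a i * G i s x + (if s is [::] then c else 0)).
Proof.
move=> HG.
have fE s : (fun x => \sum_i a i * G i s x + (if s is [::] then c else 0)) =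
    \sum_i (a i *: G i s) + cst (if s is [::] then c else 0).
  by apply/funext => x; rewrite /= !fctE fct_sumE.
have dG s x i : U x -> differentiable (a i *: G i s) x.
  by move=> Ux; apply: differentiableZ; exact: (jet_differentiable (HG i)).
split.
- move=> s x Ux; rewrite fE; apply: differentiableD => //.
  by apply: differentiable_sum => i; exact: dG.
- move=> s j x Ux; rewrite fE deriveD//; last first.
    by apply: derivable_sum => i; apply: diff_derivable; exact: dG.
  rewrite derive_cst derive_sum; last by move=> i; apply: diff_derivable; exact: dG.
  congr (_ + _); apply: eq_bigr => i _; rewrite deriveZ.
    by rewrite (jet_derive (HG i)).
  by apply: diff_derivable; exact: (jet_differentiable (HG i)).
- move=> x Ux.
  have ta : \forall y \near x, forall i,
      summability.partial_sum (jet_term (G i) x y) @ summability.totally --> G i [::] y.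
    apply: (@filter_forall _ _ _ (nbhs x)) => i; exact: (jet_taylor (HG i)).
  apply: filterS ta => y ta.
  pose dl (b : {ffun 'I_k -> nat}) : R := if b == [ffun=> 0%N] then c else 0.
  pose F := @summability.totally {ffun 'I_k -> nat}.
  have FF : ProperFilter F := summability.totally_filter.
  have index0 (b : {ffun 'I_k -> nat}) :
      (if index_seq b is [::] then c else 0) = dl b.
    rewrite /dl; have [->|b0] := eqVneq b [ffun=> 0%N].
      rewrite (_ : index_seq _ = [::])// /index_seq.
      by elim: (enum _) => //= i s IH; rewrite ffunE.
    have [i bi] : exists i, b i != 0%N.
      apply/existsP; apply: contra_neqT b0; rewrite negb_exists => /forallP h.
      by apply/ffunP => i; rewrite ffunE; apply/eqP; have := h i; rewrite negbK.
    have : i \in index_seq b.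
      apply/flattenP; exists (nseq (b i) i); last by rewrite mem_nseq lt0n bi eqxx.
      by apply: map_f; rewrite mem_enum.
    by case: (index_seq b).
  have termE b : jet_term (fun s x => \sum_i a i * G i s x +
      (if s is [::] then c else 0)) x y b =
      \sum_i a i * jet_term (G i) x y b + dl b.
    rewrite /jet_term index0 !mulrDl !mulr_suml; congr (_ + _).
      by apply: eq_bigr => i _; rewrite !mulrA.
    rewrite /dl; have [->|b0] := eqVneq b [ffun=> 0%N]; last by rewrite !mul0r.
    rewrite !big1 ?divr1 ?mulr1// => i _; rewrite ffunE ?expr0//.
  have -> : summability.partial_sum (jet_term (fun s x => \sum_i a i * G i s x +
      (if s is [::] then c else 0)) x y) = (fun A : {fset {ffun 'I_k -> nat}} =>
      \sum_i a i * summability.partial_sum (jet_term (G i) x y) A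
      + summability.partial_sum dl A).
    apply/funext => A; rewrite /summability.partial_sum.
    under eq_bigr do rewrite termE.
    rewrite big_split /= exchange_big /=; congr (_ + _).
    by apply: eq_bigr => i _; rewrite mulr_sumr.
  apply: (@cvgD R R^o _ F _); last first.
    have ev : \forall A \near F, summability.partial_sum dl A = c.
      exists [fset [ffun=> 0%N]]%fset => //= A /=; rewrite fsub1set => A0.
      rewrite /summability.partial_sum (bigD1 [` A0]%fset) //= big1 => [|b b0].
        by rewrite addr0 /dl eqxx.
      by rewrite /dl -(inj_eq val_inj)/= in b0 *; rewrite (negbTE b0).
    exact: (@cvg_near_cst _ R^o c _ F _ ev).
  elim: (index_enum _) => [|i r IH].
    rewrite big_nil (_ : (fun A => _) = cst 0).
      exact: (@cvg_cst _ (0 : R) _ F _).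
    by apply/funext => A; rewrite big_nil.
  rewrite big_cons (_ : (fun A => _) = fun A =>
    a i * summability.partial_sum (jet_term (G i) x y) A +
    \sum_(i <- r) a i * summability.partial_sum (jet_term (G i) x y) A).
    apply: (@cvgD R R^o _ F _); last exact: IH.
    by apply: (@cvgM R _ F _); [exact: (@cvg_cst _ _ _ F _)|exact: ta].
  by apply/funext => A; rewrite big_cons.
Qed.

Lemma jet_terms0 G (x y : 'rV[R]_k) :
  (forall a, jet_term G x y a = 0) ->
  summability.partial_sum (jet_term G x y) @ summability.totally --> G [::] y ->
  G [::] y = 0.
Proof.
move=> t0 cv.
have ps0 : summability.partial_sum (jet_term G x y) = cst 0.
  by apply/funext => A; rewrite /summability.partial_sum big1.
rewrite ps0 in cv.
have FF : ProperFilter (@summability.totally {ffun 'I_k -> nat}) := summability.totally_filter.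
apply: (cvg_unique (@norm_hausdorff R R^o) cv).
exact: (@cvg_cst _ (0 : R) _ (@summability.totally {ffun 'I_k -> nat}) _).
Qed.

Lemma jet_flat_near0 U G x : analytic_jet U G -> U x ->
  (forall s, G s x = 0) -> \forall y \near x, G [::] y = 0.
Proof.
move=> HG Ux G0; apply: filterS (jet_taylor HG Ux) => y.
by apply: jet_terms0 => // a; rewrite /jet_term G0 !mul0r.
Qed.

Lemma index_seq_single (a : {ffun 'I_k -> nat}) j :
  (forall i, i != j -> a i = 0%N) -> index_seq a = nseq (a j) j.
Proof.
move=> a0; rewrite /index_seq.
have : forall s, uniq s -> flatten [seq nseq (a i) i | i <- s] =
    if j \in s then nseq (a j) j else [::].
  elim=> //= i s IH /andP[ins us]; rewrite IH// inE.
  have [<-|ij] := eqVneq i j; first by rewrite /= (negbTE ins) cats0.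
  by rewrite a0.
by move=> ->; rewrite ?enum_uniq// mem_enum.
Qed.

(** On a coordinate line, a Taylor term with an exponent off that coordinate has
    a zero factor, so only the pure derivatives along the line matter. *)
Lemma jet_line_near0 U G x j : analytic_jet U G -> U x ->
  (forall r, G (nseq r j) x = 0) ->
  exists2 e, 0 < e & forall t, `|t| < e -> G [::] (x + t *: 'e_j) = 0.
Proof.
move=> HG Ux G0; have /nbhs_ballP[e /= e0 He] := jet_taylor HG Ux.
have en : 0 < e / (`|'e_j : 'rV[R]_k| + 1) by rewrite divr_gt0// ltr_wpDl.
exists (e / (`|'e_j : 'rV[R]_k| + 1)) => // t te.
apply: jet_terms0 => [a|]; last first.
  apply: He; rewrite -ball_normE /= opprD addNKr normrN normrZ.
  apply: (@le_lt_trans _ _ (`|t| * (`|'e_j : 'rV[R]_k| + 1))).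
    by rewrite ler_wpM2l// lerDl.
  by rewrite -ltr_pdivlMr// ltr_wpDl.
have [/existsP[i /andP[ij ai]]|] := boolP [exists i, (i != j) && (a i != 0%N)].
  rewrite /jet_term [X in _ * X](bigD1 i)//= !mxE (negbTE ij) mulr0 addr0 subrr.
  by rewrite expr0n (negbTE ai) mul0r mulr0.
rewrite negb_exists => /forallP h.
rewrite /jet_term (@index_seq_single a j) ?G0 ?mul0r// => i ij.
by have := h i; rewrite ij /= negbK => /eqP.
Qed.

Lemma is_derive_line (g : 'rV[R]_k -> R) (p e : 'rV[R]_k) (t : R) :
  differentiable g (p + t *: e) ->
  is_derive t 1 (fun s : R => g (p + s *: e)) ('D_e g (p + t *: e)).
Proof.
move=> /(@diff_derivable _ _ _ _ _ e); rewrite /derivable.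
have E : (fun h : R => h^-1 *: ((g \o shift (p + t *: e)) (h *: e) - g (p + t *: e))) =
  (fun h : R => h^-1 *: (((fun s : R => g (p + s *: e)) \o shift t) (h *: 1) - g (p + t *: e))).
  apply/funext => h /=; congr (_ *: (g _ - _)).
  by rewrite [h *: 1]mulr1 scalerDl addrCA addrA.
by rewrite E => dl; split => //; rewrite /derive E.
Qed.

Lemma jet_line_derive U G s p j t : analytic_jet U G -> U (p + t *: 'e_j) ->
  is_derive t 1 (fun u : R => G s (p + u *: 'e_j)) (G (j :: s) (p + t *: 'e_j)).
Proof.
move=> HG Up; rewrite -(jet_derive HG)//.
exact/is_derive_line/(jet_differentiable HG).
Qed.

Lemma jet_line_continuous U G s p j t : analytic_jet U G -> U (p + t *: 'e_j) ->
  {for t, continuous (fun u : R => G s (p + u *: 'e_j))}.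
Proof.
move=> HG Up; apply: differentiable_continuous; apply/derivable1_diffP.
by have [] := jet_line_derive s HG Up.
Qed.

Lemma jet_continuous U G s x : analytic_jet U G -> U x -> G s u @[u --> x] --> G s x.
Proof.
move=> HG Ux.
exact: (differentiable_continuous (jet_differentiable HG s Ux)).
Qed.

End jets.

(** * Zero sets of analytic functions along coordinate lines *)

Lemma norm_delta_le1 (R : realType) (k : nat) (j : 'I_k) : `|'e_j : 'rV[R]_k| <= 1.
Proof.
rewrite [leLHS]/Num.norm /= mx_normrE; apply: bigmax_le => // -[a b] _ /=.
by rewrite mxE; case: (_ && _); rewrite ?normr1 ?normr0.
Qed.

Lemma norm_line_le (R : realType) (k : nat) (j : 'I_k) (u v : 'rV[R]_k) (t : R) :
  `|v - (u + t *: 'e_j)| <= `|v - u| + `|t|.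
Proof.
rewrite opprD addrA (le_trans (ler_normB _ _))// lerD2l normrZ ler_piMr//.
exact: norm_delta_le1.
Qed.

Lemma line_mean_value (R : realType) (c d : R -> R) (T : R) :
  (forall s : R, `|s| <= `|T| -> is_derive s 1 c (d s)) ->
  exists2 x, `|x| <= `|T| & c T - c 0 = d x * T.
Proof.
move=> der.
have cont a b : (forall s, s \in `[a, b] -> `|s| <= `|T|) -> {within `[a, b], continuous c}.
  move=> ab; apply: continuous_in_subspaceT => x /set_mem/ab/der[dx _].
  exact/differentiable_continuous/derivable1_diffP.
have [T0|T0] := leP 0 T.
  have in_T s : s \in `[0, T] -> `|s| <= `|T|.
    by rewrite in_itv /= => /andP[s0 sT]; rewrite !ger0_norm.
  have der_T (s : R) : s \in `]0, T[ -> is_derive s 1 c (d s).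
    by move=> sT; exact/der/in_T/subset_itv_oo_cc.
  have [x xT] := MVT_segment T0 der_T (cont _ _ in_T).
  by rewrite subr0; exists x => //; exact: in_T.
have in_T s : s \in `[T, 0] -> `|s| <= `|T|.
  by rewrite in_itv /= => /andP[s0 sT]; rewrite !ler0_norm ?(ltW T0)// lerN2.
have der_T (s : R) : s \in `]T, 0[ -> is_derive s 1 c (d s).
  by move=> sT; exact/der/in_T/subset_itv_oo_cc.
have [x xT e] := MVT_segment (ltW T0) der_T (cont _ _ in_T).
by exists x; [exact: in_T|rewrite -opprB e; ring].
Qed.

(** If c vanishes to order r at 0 and once more at t, then each derivative up to
    the r-th has a zero between 0 and t other than 0. *)
Lemma iterated_rolle (R : realType) (c : nat -> R -> R) (r : nat) (t : R) :
  (forall i (s : R), `|s| <= `|t| -> is_derive s 1 (c i) (c i.+1 s)) ->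
  (forall i, (i < r)%N -> c i 0 = 0) -> t != 0 -> c 0%N t = 0 ->
  exists s, [/\ s != 0, `|s| <= `|t| & c r s = 0].
Proof.
move=> der c0 t0 ct; elim: r c0 => [|r IH] c0; first by exists t.
have [s [s0 st cs]] := IH (fun i ir => c0 i (leqW ir)).
have cont a b : (forall x, x \in `[a, b] -> `|x| <= `|t|) -> {within `[a, b], continuous (c r)}.
  move=> ab; apply: continuous_in_subspaceT => x /set_mem/ab/(der r)[dx _].
  exact/differentiable_continuous/derivable1_diffP.
have fin (x : R) : x != 0 -> `|x| <= `|t| -> is_derive x 1 (c r) 0 ->
    exists s, [/\ s != 0, `|s| <= `|t| & c r.+1 s = 0].
  move=> x0 xt [_ dx]; exists x; split => //.
  by have [_ <-] := der r x xt.
have [s_gt0|s_le0] := ltP 0 s.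
  have in_t x : x \in `[0, s] -> `|x| <= `|t|.
    rewrite in_itv /= => /andP[x0 xs]; apply: le_trans st.
    by rewrite !ger0_norm// ltW.
  have der_t (x : R) : x \in `]0, s[ -> derivable (c r) x 1.
    by move=> xs; have [] := der r x (in_t _ (subset_itv_oo_cc xs)).
  have [x xs dx] := Rolle s_gt0 der_t (cont _ _ in_t) (etrans (c0 r (leqnn _)) (esym cs)).
  apply: (fin x) => //; last exact/in_t/subset_itv_oo_cc.
  by move: xs; rewrite in_itv /= => /andP[/gt_eqF->].
have s_lt0 : s < 0 by rewrite lt_neqAle s0.
have in_t x : x \in `[s, 0] -> `|x| <= `|t|.
  rewrite in_itv /= => /andP[x0 xs]; apply: le_trans st.
  by rewrite !ler0_norm// lerN2.
have der_t (x : R) : x \in `]s, 0[ -> derivable (c r) x 1.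
  by move=> xs; have [] := der r x (in_t _ (subset_itv_oo_cc xs)).
have [x xs dx] := Rolle s_lt0 der_t (cont _ _ in_t) (etrans cs (esym (c0 r (leqnn _)))).
apply: (fin x) => //; last exact/in_t/subset_itv_oo_cc.
by move: xs; rewrite in_itv /= => /andP[_ /lt_eqF->].
Qed.

Section lines.
Context (R : realType) (k : nat).
Implicit Types (U : set 'rV[R]_k) (G H : seq 'I_k -> 'rV[R]_k -> R).

Lemma near_translate (P : set 'rV[R]_k) (v w : 'rV[R]_k) :
  nbhs (v + w) P -> \forall u \near v, P (u + w).
Proof.
move=> /nbhs_ballP[e /= e0 He]; apply/nbhs_ballP; exists e => //= u.
rewrite -ball_normE /= => vu; apply: He.
by rewrite -ball_normE /= opprD addrACA subrr addr0.
Qed.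

Lemma near_line (P : set 'rV[R]_k) (v : 'rV[R]_k) j (t : R) :
  nbhs (v + t *: 'e_j) P -> \forall s \near t, P (v + s *: 'e_j).
Proof.
move=> /nbhs_ballP[e /= e0 He]; apply/nbhs_ballP; exists e => //= s.
rewrite /ball /= => ts; apply: He.
rewrite -ball_normE /= opprD addrACA subrr add0r -scalerBl normrZ.
by apply: le_lt_trans ts; rewrite ler_piMr// norm_delta_le1.
Qed.

(** The one-variable identity theorem: the set where all derivatives along the
    line vanish is closed by continuity, open by Taylor expansion, and a segment
    is connected. *)
Lemma jet_line_identity U G v j (T : R) : open U -> analytic_jet U G -> 0 <= T ->
  (forall t, `|t| <= T -> U (v + t *: 'e_j)) -> (forall r, G (nseq r j) v = 0) ->
  forall t, `|t| <= T -> G [::] (v + t *: 'e_j) = 0.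
Proof.
move=> Uop HG T0 UT Gv.
pose c r t := G (nseq r j) (v + t *: 'e_j).
have AE t : `[- T, T]%classic t <-> `|t| <= T by rewrite /= in_itv /= ler_norml.
pose B := [set t | `|t| <= T /\ forall r, c r t = 0].
have ccont r t : `|t| <= T -> {for t, continuous (c r)}.
  by move=> tT; exact: (@jet_line_continuous _ _ U G (nseq r j) v j t HG (UT t tT)).
suff BE : B = `[- T, T]%classic by move=> t /AE; rewrite -BE => -[_ /(_ 0%N)].
apply: (@segment_connected R (- T) T).
- exists 0; split; first by rewrite normr0.
  by move=> r; rewrite /c scale0r addr0.
- exists [set t | \forall s \near t, c 0%N s = 0].
    by rewrite openE => t /= tn; exact: nbhs_interior.
  apply/seteqP; split => [t [tT ct]|t [tT /= tn]] /=.
    split; first exact/AE.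
    have [e e0 He] := jet_line_near0 HG (UT t tT) (ct : forall r, G (nseq r j) (v + t *: 'e_j) = 0).
    apply/nbhs_ballP; exists e => //= s; rewrite /ball /= distrC => /He.
    by rewrite -addrA -scalerDl [t + _]addrC subrK.
  have {}tT : `|t| <= T by exact/AE.
  split=> // r.
  suff : \forall s \near t, c r s = 0 by move/nbhs_singleton.
  elim: r => [//|r IH].
  have Us : \forall s \near t, U (v + s *: 'e_j).
    by apply: near_line; exact: open_nbhs_nbhs (conj Uop (UT t tT)).
  apply: filterS2 (nbhs_interior IH) Us => s sn Us.
  have [_ dE] := jet_line_derive (nseq r j) HG Us; rewrite /c /= -dE.
  have : {near s, (fun u : R => G (nseq r j) (v + u *: 'e_j)) =1 cst 0} by exact: sn.
  by move=> /near_eq_derive ->; rewrite derive_cst.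
- exists (closure B); first exact: closed_closure.
  apply/seteqP; split => [t tB|t [/AE tT clt]].
    by split; [apply/AE; case: tB|exact: subset_closure].
  split=> // r; apply: contrapT => /eqP crt.
  have /clt[s [[_ Bs] /eqP]] : nbhs t [set s | c r s != 0].
    by exact: (cvgr_neq0 _ (ccont r t tT) crt).
  by apply; exact: Bs.
Qed.

Lemma jet_sign U G s x (c : R) : analytic_jet U G -> U x ->
  0 < G s x * c -> \forall u \near x, 0 < G s u * c.
Proof.
move=> HG Ux; have h := @jet_continuous R k U G s x HG Ux.
have cM : (G s u * c) @[u --> x] --> G s x * c.
  by apply: (@cvgM R _ (nbhs x) _); [exact: h|exact: (@cvg_cst _ _ _ (nbhs x) _)].
by move=> G0; exact: (@cvgr_gt R _ (nbhs x) _ _ _ cM 0 G0).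
Qed.

Lemma jet_neq0_near U G s x : analytic_jet U G -> U x ->
  G s x != 0 -> \forall u \near x, G s u != 0.
Proof.
move=> HG Ux Gx; have : 0 < G s x * G s x by rewrite -expr2 lt_def sqr_ge0 sqrf_eq0 Gx.
move=> /(jet_sign HG Ux); apply: filterS => u; apply: contraTneq => ->.
by rewrite mul0r ltxx.
Qed.

(** H changes sign across v in the direction e_j; it still does on nearby
    parallel lines, and the intermediate value theorem applies there.  This is
    the part of the implicit function theorem that is needed below. *)
Lemma jet_zero_on_line U H v j (sigma : R) : open U -> analytic_jet U H -> U v ->
  H [::] v = 0 -> H [:: j] v != 0 -> 0 < sigma ->
  \forall u \near v, exists2 t, `|t| < sigma & H [::] (u + t *: 'e_j) = 0.
Proof.
move=> Uop HH Uv Hv dH s0; pose D := H [:: j] v.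
have A1 : \forall u \near v, 0 < H [:: j] u * D.
  by apply: (jet_sign HH Uv); rewrite -expr2 lt_def sqr_ge0 sqrf_eq0 dH.
have /nbhs_ballP[e /= e0 He] : nbhs v (U `&` [set u | 0 < H [:: j] u * D]).
  by apply: filterI => //; exact: open_nbhs_nbhs.
pose T := Num.min e sigma / 4.
have T0 : 0 < T by rewrite divr_gt0// lt_min e0.
have Te : T <= e / 4 by rewrite ler_pM2r// ge_min lexx.
have Ts : T < sigma.
  by have : Num.min e sigma <= sigma by [rewrite ge_min lexx orbT]; rewrite /T; lra.
have inb u t : `|v - u| < e / 2 -> `|t| <= T -> ball v e (u + t *: 'e_j).
  move=> vu tT; rewrite -ball_normE /=; apply: le_lt_trans (norm_line_le _ _ _ _) _.
  by lra.
have v0 : `|v - v| < e / 2 by rewrite subrr normr0 divr_gt0.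
have incr (t0 : R) : H [::] (v + t0 *: 'e_j) * D =
    (H [::] (v + t0 *: 'e_j) - H [::] (v + 0 *: 'e_j)) * D.
  by rewrite scale0r addr0 Hv subr0.
have sgn (t0 : R) : `|t0| <= T -> t0 != 0 -> 0 < H [::] (v + t0 *: 'e_j) * D * t0.
  move=> tT tn0; rewrite incr.
  have [s st|x xt ->] := @line_mean_value R (fun s => H [::] (v + s *: 'e_j))
      (fun s => H [:: j] (v + s *: 'e_j)) t0.
    apply: (jet_line_derive _ HH); have [] // := He (v + s *: 'e_j).
    by apply: inb => //; exact: le_trans tT.
  have [_ /=] := He (v + x *: 'e_j) (inb _ _ v0 (le_trans xt tT)).
  move=> h; have -> : forall a : R, a * t0 * D * t0 = a * D * t0 ^+ 2 by move=> a; ring.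
  by rewrite mulr_gt0// lt_def sqr_ge0 sqrf_eq0 tn0.
have TT : `|T| <= T by rewrite ger0_norm// ltW.
have TN : `|- T| <= T by rewrite normrN.
have near_sgn (t0 : R) : `|t0| <= T -> t0 != 0 ->
    \forall u \near v, 0 < H [::] (u + t0 *: 'e_j) * D * t0.
  move=> tT tn0; apply: (@near_translate [set u | 0 < H [::] u * D * t0]).
  have Ut : U (v + t0 *: 'e_j) by have [] := He _ (inb _ _ v0 tT).
  have := sgn _ tT tn0; rewrite -mulrA => /(jet_sign HH Ut).
  by apply: filterS => u; rewrite mulrA.
have A2 := near_sgn T TT (lt0r_neq0 T0).
have A3 : \forall u \near v, 0 < H [::] (u + - T *: 'e_j) * D * - T.
  by apply: near_sgn => //; rewrite oppr_eq0 lt0r_neq0.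
have A4 : nbhs v [set u | `|v - u| < e / 2].
  by apply/nbhs_ballP; exists (e / 2) => /=; [rewrite divr_gt0|rewrite -ball_normE].
apply: filterS3 A2 A3 A4 => u h1 h2 vu.
have NTT : - T <= T by lra.
have [||t tT Ht] := @IVT R (fun s => H [::] (u + s *: 'e_j)) (- T) T 0 NTT.
- apply: continuous_in_subspaceT => t /set_mem; rewrite /= in_itv /= -ler_norml => tT.
  have [Ut _] := He _ (inb _ _ vu tT).
  exact: (@jet_line_continuous _ _ U H [::] u j t HH Ut).
- have [d0|d0] : 0 < D \/ D < 0 by move/lt_total: (dH : D != 0) => /orP[]; [right|left].
    have a : 0 < H [::] (u + T *: 'e_j) by move: h1; rewrite pmulr_lgt0// pmulr_lgt0//.
    have b : H [::] (u + - T *: 'e_j) < 0.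
      by move: h2; rewrite nmulr_lgt0 ?oppr_lt0// pmulr_llt0.
    by rewrite ge_min le_max (ltW a) (ltW b) orbT.
  have a : H [::] (u + T *: 'e_j) < 0 by move: h1; rewrite pmulr_lgt0// nmulr_lgt0.
  have b : 0 < H [::] (u + - T *: 'e_j).
    by move: h2; rewrite nmulr_lgt0 ?oppr_lt0// nmulr_llt0.
  by rewrite ge_min le_max (ltW a) (ltW b) orbT.
exists t => //; apply: le_lt_trans Ts; move: tT; by rewrite in_itv /= -ler_norml.
Qed.

(** Let r be the least order for which the r-th derivative of G along e_j is
    nonzero at some zero v of H near u0.  It exists: otherwise, by
    [jet_line_identity], G would vanish on all the lines through zeros of H in
    direction e_j, which cover a neighbourhood of u0.  Near v, a zero u of G
    lies on such a line; if u is not itself a zero of H, then G vanishes to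
    order r at the zero of H on that line and once more at u, so Rolle gives a
    zero of the r-th derivative, which is nonzero near v. *)
Lemma jet_zero_set_local U G H j u0 (O : set 'rV[R]_k) :
  open U -> analytic_jet U H -> analytic_jet U G -> U u0 ->
  H [::] u0 = 0 -> H [:: j] u0 != 0 ->
  ~ (\forall u \near u0, G [::] u = 0) ->
  nbhs u0 O -> (forall v, O v -> H [::] v = 0 -> G [::] v = 0) ->
  exists v, [/\ O v, U v, H [::] v = 0 &
    \forall u \near v, G [::] u = 0 -> H [::] u = 0].
Proof.
move=> Uop HH HG Uu0 Hu0 dH Gn0 Ou0 OG.
have A1 : nbhs u0 [set u | H [:: j] u != 0].
  exact: (jet_neq0_near HH Uu0 dH).
have /nbhs_ballP[rho /= rho0 Hrho] : nbhs u0 ((U `&` O) `&` [set u | H [:: j] u != 0]).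
  by apply: filterI => //; apply: filterI => //; exact: open_nbhs_nbhs.
have [r0 [v0 [bv0 Hv0 Gv0]]] : exists r v, [/\ ball u0 rho v, H [::] v = 0 & G (nseq r j) v != 0].
  apply: contrapT => none; apply: Gn0.
  have flat v r : ball u0 rho v -> H [::] v = 0 -> G (nseq r j) v = 0.
    by move=> bv Hv; apply: contrapT => /eqP h; apply: none; exists r, v.
  have r4 : 0 < rho / 4 by rewrite divr_gt0.
  have A2 : nbhs u0 (ball u0 (rho / 4)) by exact: nbhsx_ballx.
  apply: filterS2 A2 (jet_zero_on_line Uop HH Uu0 Hu0 dH r4) => u.
  rewrite -ball_normE /= => uu [t tr Ht].
  have -> : u = (u + t *: 'e_j) + (- t) *: 'e_j by rewrite scaleNr addrK.
  apply: (@jet_line_identity U G _ j `|t|) => //; last by rewrite normrN.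
  - move=> s st; have [|[] //] := Hrho ((u + t *: 'e_j) + s *: 'e_j).
    rewrite -ball_normE /= -addrA -scalerDl; apply: le_lt_trans (norm_line_le _ _ _ _) _.
    by have := ler_normD t s; lra.
  - move=> r; apply: flat => //; rewrite -ball_normE /=.
    by apply: le_lt_trans (norm_line_le _ _ _ _) _; lra.
have ex : exists r, `[< exists v, [/\ ball u0 rho v, H [::] v = 0 & G (nseq r j) v != 0] >].
  by exists r0; apply/asboolP; exists v0.
case: (ex_minnP ex) => r /asboolP[v [bv Hv Gv]] rmin.
have flat i w : (i < r)%N -> ball u0 rho w -> H [::] w = 0 -> G (nseq i j) w = 0.
  move=> ir bw Hw; apply: contrapT => /eqP h.
  by have := rmin i; rewrite leqNgt ir => /(_ (asboolT (ex_intro _ w (And3 bw Hw h)))).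
have [[Uv Ov] dHv] := Hrho _ bv.
exists v; split => //.
have A2 : nbhs v [set u | G (nseq r j) u != 0].
  exact: (jet_neq0_near HG Uv Gv).
have A3 : nbhs v (ball u0 rho) by by apply: open_nbhs_nbhs; split => //; exact: ball_open.
have /nbhs_ballP[e /= e0 He] : nbhs v (ball u0 rho `&` [set u | G (nseq r j) u != 0]).
  exact: filterI.
have e4 : 0 < e / 4 by rewrite divr_gt0.
have A4 : nbhs v (ball v (e / 4)) by exact: nbhsx_ballx.
apply: filterS2 A4 (jet_zero_on_line Uop HH Uv Hv dHv e4) => u.
rewrite -ball_normE /= => vu [t te Ht] Gu.
apply: contrapT => Hu.
have tn0 : t != 0 by apply/eqP => t0; apply: Hu; rewrite -Ht t0 scale0r addr0.
pose w := u + t *: 'e_j.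
have inb s : `|s| <= `|t| -> ball v e (w + s *: 'e_j).
  move=> st; rewrite /w -ball_normE /= -addrA -scalerDl.
  by apply: le_lt_trans (norm_line_le _ _ _ _) _; have := ler_normD t s; lra.
have bw : ball u0 rho w.
  by have [] := He (w + 0 *: 'e_j) (inb 0 _); rewrite ?normr0 // scale0r addr0.
have [||||s [_ st Gs]] := @iterated_rolle R (fun i s => G (nseq i j) (w + s *: 'e_j)) r (- t).
- move=> i s; rewrite normrN => st; apply: (jet_line_derive _ HG).
  by have [bws _] := He _ (inb s st); have [[]] := Hrho _ bws.
- by move=> i ir; rewrite scale0r addr0; exact: flat.
- by rewrite oppr_eq0.
- by rewrite /w scaleNr addrK.
rewrite normrN in st.
by have [_ /=] := He _ (inb s st); rewrite Gs eqxx.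
Qed.

End lines.

(** * Pairs of functions with nonzero Jacobian minor *)

Section open_pair.
Context (R : realType) (k : nat).
Implicit Types (U : set 'rV[R]_k) (A B : seq 'I_k -> 'rV[R]_k -> R).

Lemma jet_near_value U A s x (e : R) : analytic_jet U A -> U x -> 0 < e ->
  \forall u \near x, `|A s u - A s x| < e.
Proof.
move=> HA Ux e0; have h := @jet_continuous R k U A s x HA Ux.
exact: (@cvgr_distC_lt R R^o _ (nbhs x) _ _ _ h e e0).
Qed.

Lemma compact_square (d : R) :
  compact [set w : R * R | `|w.1| <= d /\ `|w.2| <= d].
Proof.
rewrite (_ : mkset _ = `[- d, d]%classic `*` `[- d, d]%classic).
  by apply: compact_setX; exact: segment_compact.
by apply/seteqP; split => -[a b] /=; rewrite !in_itv /= !ler_norml.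
Qed.

Lemma is_derive_sum_sqr (c c' : R -> R) (dc dc' y y' s : R) :
  is_derive s 1 c dc -> is_derive s 1 c' dc' ->
  is_derive s 1 (fun s => (c s - y) ^+ 2 + (c' s - y') ^+ 2)
    (2 * ((c s - y) * dc + (c' s - y') * dc')).
Proof.
move=> hc hc'.
rewrite (_ : (fun s => _) = (c - cst y) * (c - cst y) + (c' - cst y') * (c' - cst y'))//.
apply: is_derive_eq.
rewrite !subr0 /= !fctE /= /GRing.scale /=; ring.
Qed.

Lemma jet_square_increment U A u0 i j (d s t : R) : analytic_jet U A ->
  (forall a b : R, `|a| <= d -> `|b| <= d -> U (u0 + a *: 'e_i + b *: 'e_j)) ->
  `|s| <= d -> `|t| <= d ->
  exists a b, [/\ `|a| <= d, `|b| <= d &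
    A [::] (u0 + s *: 'e_i + t *: 'e_j) - A [::] u0 =
    A [:: i] (u0 + a *: 'e_i + 0 *: 'e_j) * s + A [:: j] (u0 + s *: 'e_i + b *: 'e_j) * t].
Proof.
move=> HA UP sd td.
have d0 : `|0 : R| <= d by rewrite normr0 (le_trans _ sd).
have [a aS ea] := @line_mean_value R (fun x => A [::] (u0 + x *: 'e_i))
  (fun x => A [:: i] (u0 + x *: 'e_i)) s
  (fun x xs => jet_line_derive [::] HA (ltac:(by
     have := UP x 0 (le_trans xs sd) d0; rewrite scale0r addr0) : U (u0 + x *: 'e_i))).
have [b bT eb] := @line_mean_value R (fun x => A [::] (u0 + s *: 'e_i + x *: 'e_j))
  (fun x => A [:: j] (u0 + s *: 'e_i + x *: 'e_j)) t
  (fun x xt => jet_line_derive [::] HA (UP s x sd (le_trans xt td))).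
exists a, b; split; [exact: le_trans sd|exact: le_trans td|].
rewrite !scale0r !addr0 in ea eb *.
by rewrite -ea -eb [RHS]addrC addrA subrK.
Qed.

(** For a Jacobian matrix equal to the identity at u0, minimise the squared
    distance from (A, B) to the target (y1, y2) over a small square in the plane
    of directions i and j.  On the border the mean value theorem keeps (A, B)
    far from its value at u0, hence from the target, so the minimum is interior;
    there the gradient vanishes, and since the Jacobian is still invertible the
    distance is 0. *)
Lemma jet_pair_open_normal U A B i j u0 (N : set 'rV[R]_k) :
  open U -> analytic_jet U A -> analytic_jet U B -> U u0 ->
  A [:: i] u0 = 1 -> A [:: j] u0 = 0 -> B [:: i] u0 = 0 -> B [:: j] u0 = 1 ->
  nbhs u0 N ->
  exists2 eps, 0 < eps & forall y1 y2, `|y1 - A [::] u0| < eps ->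
    `|y2 - B [::] u0| < eps -> exists u, [/\ N u, A [::] u = y1 & B [::] u = y2].
Proof.
move=> Uop HA HB Uu0 Ai Aj Bi Bj Nu0.
have q0 : 0 < 1 / 4 :> R by rewrite divr_gt0.
have /nbhs_ballP[e /= e0 He] : nbhs u0 ((U `&` N) `&`
    (([set u | `|A [:: i] u - A [:: i] u0| < 1 / 4] `&`
      [set u | `|A [:: j] u - A [:: j] u0| < 1 / 4]) `&`
     ([set u | `|B [:: i] u - B [:: i] u0| < 1 / 4] `&`
      [set u | `|B [:: j] u - B [:: j] u0| < 1 / 4]))).
  apply: filterI; first by apply: filterI => //; exact: open_nbhs_nbhs.
  apply: filterI; apply: filterI.
  - exact: jet_near_value HA Uu0 q0.
  - exact: jet_near_value HA Uu0 q0.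
  - exact: jet_near_value HB Uu0 q0.
  - exact: jet_near_value HB Uu0 q0.
rewrite Ai Aj Bi Bj in He.
pose d := e / 4; have d0 : 0 < d by rewrite divr_gt0.
pose P (s t : R) := u0 + s *: 'e_i + t *: 'e_j.
have inb s t : `|s| <= d -> `|t| <= d -> ball u0 e (P s t).
  move=> sd td; rewrite -ball_normE /=; apply: le_lt_trans (norm_line_le _ _ _ _) _.
  apply: (@le_lt_trans _ _ (d + d)); last by rewrite /d; lra.
  rewrite lerD//; apply: le_trans sd; apply: le_trans (norm_line_le _ _ _ _) _.
  by rewrite subrr normr0 add0r.
have UP s t : `|s| <= d -> `|t| <= d -> U (P s t) by move=> sd td; have [[]] := He _ (inb _ _ sd td).
have d00 : `|0 : R| <= d by rewrite normr0 ltW.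
have aux (X Y s t : R) : `|X - 1| < 1 / 4 -> `|Y| < 1 / 4 ->
    `|X * s + Y * t - s| <= (`|s| + `|t|) / 4.
  move=> h1 h2; have -> : X * s + Y * t - s = (X - 1) * s + Y * t by ring.
  rewrite (le_trans (ler_normD _ _))// !normrM.
  have s0 := normr_ge0 s; have t0 := normr_ge0 t.
  by have := ler_wpM2r s0 (ltW h1); have := ler_wpM2r t0 (ltW h2); lra.
have incA s t : `|s| <= d -> `|t| <= d ->
    `|A [::] (P s t) - A [::] u0 - s| <= (`|s| + `|t|) / 4.
  move=> sd td; have [a [b [ad bd ->]]] := jet_square_increment HA UP sd td.
  have [_ [[/= h1 _] _]] := He _ (inb _ _ ad d00); have [_ [[_ /= h2] _]] := He _ (inb _ _ sd bd).
  by rewrite subr0 in h2; exact: aux.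
have incB s t : `|s| <= d -> `|t| <= d ->
    `|B [::] (P s t) - B [::] u0 - t| <= (`|s| + `|t|) / 4.
  move=> sd td; have [a [b [ad bd ->]]] := jet_square_increment HB UP sd td.
  have [_ [_ [/= h1 _]]] := He _ (inb _ _ ad d00); have [_ [_ [_ /= h2]]] := He _ (inb _ _ sd bd).
  by rewrite subr0 in h1; rewrite [X in X - _]addrC [X in _ <= X / 4]addrC; exact: aux.
exists (d / 8); first by rewrite divr_gt0.
move=> y1 y2 Hy1 Hy2.
pose f (w : R * R) := (A [::] (P w.1 w.2) - y1) ^+ 2 + (B [::] (P w.1 w.2) - y2) ^+ 2.
pose K := [set w : R * R | `|w.1| <= d /\ `|w.2| <= d].
have Kf : {within K, continuous f}.
  apply: continuous_in_subspaceT => w /set_mem[w1 w2].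
  have Pw : P z.1 z.2 @[z --> w] --> P w.1 w.2.
    apply/cvgrPdist_lt => eps eps0; apply/(@nbhs_ballP R (R * R)%type).
    exists (eps / 2) => /=; first by rewrite divr_gt0.
    move=> z [/= z1 z2]; rewrite /P opprD addrACA -scalerBl.
    rewrite opprD addrACA subrr add0r -scalerBl.
    have n1 (j' : 'I_k) (c : R) : `|c *: 'e_j' : 'rV[R]_k| <= `|c|.
      by rewrite normrZ ler_piMr// norm_delta_le1.
    rewrite (le_lt_trans (ler_normD _ _))// [ltRHS](splitr eps) ltrD//.
      exact: le_lt_trans (n1 _ _) z1.
    exact: le_lt_trans (n1 _ _) z2.
  have cA : A [::] (P z.1 z.2) @[z --> w] --> A [::] (P w.1 w.2).
    have h := @jet_continuous R k U A [::] _ HA (UP _ _ w1 w2).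
    exact: (@cvg_comp _ _ _ (fun z : R * R => P z.1 z.2) (A [::]) (nbhs w)
      (nbhs (P w.1 w.2)) (nbhs (A [::] (P w.1 w.2))) Pw h).
  have cB : B [::] (P z.1 z.2) @[z --> w] --> B [::] (P w.1 w.2).
    have h := @jet_continuous R k U B [::] _ HB (UP _ _ w1 w2).
    exact: (@cvg_comp _ _ _ (fun z : R * R => P z.1 z.2) (B [::]) (nbhs w)
      (nbhs (P w.1 w.2)) (nbhs (B [::] (P w.1 w.2))) Pw h).
  have sq (F : R * R -> R) l c : F z @[z --> w] --> l ->
      (F z - c) ^+ 2 @[z --> w] --> (l - c) ^+ 2.
    move=> Fl; have Fc : (F z - c) @[z --> w] --> l - c.
      by apply: (@cvgB R R^o _ (nbhs w) _); [exact: Fl|exact: (@cvg_cst _ _ _ (nbhs w) _)].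
    exact: (@cvgM R _ (nbhs w) _ _ _ _ _ Fc Fc).
  by apply: (@cvgD R R^o _ (nbhs w) _); exact: sq.
have [|w0 /set_mem[s0d t0d] wmin] := compact_EVT_min _ (@compact_square d) Kf.
  by exists (0, 0); split; rewrite /= normr0 ltW.
have {}wmin s t : `|s| <= d -> `|t| <= d -> f w0 <= f (s, t).
  by move=> sd td; apply: wmin; rewrite inE.
(* The value at the minimum is at most the value at the centre u0. *)
have small : f w0 < d ^+ 2 / 32.
  apply: le_lt_trans (wmin 0 0 d00 d00) _.
  rewrite /f /P /= !scale0r !addr0.
  move: Hy1 Hy2; rewrite distrC => h1; rewrite distrC => h2.
  have sq (x : R) : `|x| < d / 8 -> x ^+ 2 < d ^+ 2 / 64.
    move=> h; have -> : x ^+ 2 = `|x| * `|x|.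
      by rewrite -normrM -expr2 ger0_norm ?sqr_ge0.
    have h1' := normr_ge0 x; have : `|x| * `|x| <= `|x| * (d / 8).
      by rewrite ler_wpM2l// ltW.
    have : `|x| * (d / 8) < d / 8 * (d / 8) by rewrite ltr_pM2r// divr_gt0.
    by lra.
  by have := sq _ h1; have := sq _ h2; lra.
pose s0 := w0.1; pose t0 := w0.2.
have far (x F y0 c : R) : `|x| = d -> `|F - y0 - x| <= (d + d) / 4 ->
    `|c - y0| < d / 8 -> d ^+ 2 / 32 < (F - c) ^+ 2.
  move=> xd h1 h2.
  have h3 : 3 / 8 * d < `|F - c|.
    have : `|x| <= `|F - c| + `|c - y0| + `|F - y0 - x|.
      have -> : `|x| = `|(F - c) + (c - y0) - (F - y0 - x)| by congr `|_|; ring.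
      by rewrite (le_trans (ler_normB _ _))// lerD2r ler_normD.
    by rewrite xd; lra.
  have -> : (F - c) ^+ 2 = `|F - c| * `|F - c|.
    by rewrite -normrM -expr2 ger0_norm ?sqr_ge0.
  have d38 : 0 < 3 / 8 * d by rewrite mulr_gt0.
  have : 3 / 8 * d * (3 / 8 * d) < `|F - c| * `|F - c|.
    by rewrite ltr_pM// ltW.
  have := exprn_gt0 2 d0; rewrite expr2; lra.
have s0lt : `|s0| < d.
  rewrite lt_neqAle s0d andbT; apply/eqP => s0E.
  have h : `|A [::] (P s0 t0) - A [::] u0 - s0| <= (d + d) / 4.
    by apply: le_trans (incA _ _ s0d t0d) _; rewrite s0E; move: t0d; rewrite /t0; lra.
  have := far _ _ _ _ s0E h Hy1; move: small; rewrite /f -/s0 -/t0.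
  by have := sqr_ge0 (B [::] (P s0 t0) - y2); lra.
have t0lt : `|t0| < d.
  rewrite lt_neqAle t0d andbT; apply/eqP => t0E.
  have h : `|B [::] (P s0 t0) - B [::] u0 - t0| <= (d + d) / 4.
    by apply: le_trans (incB _ _ s0d t0d) _; rewrite t0E; move: s0d; rewrite /s0; lra.
  have := far _ _ _ _ t0E h Hy2; move: small; rewrite /f -/s0 -/t0.
  by have := sqr_ge0 (A [::] (P s0 t0) - y1); lra.
pose x := A [::] (P s0 t0) - y1; pose y := B [::] (P s0 t0) - y2.
have dd : - d <= d by lra.
have inI (s : R) : s \in `]- d, d[ -> `|s| <= d.
  by rewrite in_itv /= -ltr_norml => /ltW.
have wminE : w0 = (s0, t0) by rewrite /s0 /t0; case: (w0).
rewrite wminE in wmin.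
have crit_i : x * A [:: i] (P s0 t0) + y * B [:: i] (P s0 t0) = 0.
  have PE s : P s t0 = (u0 + t0 *: 'e_j) + s *: 'e_i by rewrite /P addrAC.
  have der (s : R) : `|s| <= d -> is_derive s 1 (fun s => f (s, t0))
      (2 * ((A [::] (P s t0) - y1) * A [:: i] (P s t0) +
            (B [::] (P s t0) - y2) * B [:: i] (P s t0))).
    move=> sd; have Us := UP s t0 sd t0d; rewrite PE in Us.
    have := is_derive_sum_sqr y1 y2 (jet_line_derive [::] HA Us) (jet_line_derive [::] HB Us).
    by rewrite /f /= -PE; under eq_fun do rewrite -PE.
  have s0in : s0 \in `]- d, d[ by rewrite in_itv /= -ltr_norml.
  have [_ e1] := derive1_at_min dd (fun s sd => @ex_derive _ _ _ _ _ _ _ (der s (inI s sd))) s0in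
    (fun s sd => wmin s t0 (inI s sd) t0d).
  have [_ e2] := der s0 s0d; move: e1; rewrite e2.
  by move=> /eqP; rewrite mulf_eq0 pnatr_eq0 /= => /eqP.
have crit_j : x * A [:: j] (P s0 t0) + y * B [:: j] (P s0 t0) = 0.
  have der (t : R) : `|t| <= d -> is_derive t 1 (fun t => f (s0, t))
      (2 * ((A [::] (P s0 t) - y1) * A [:: j] (P s0 t) +
            (B [::] (P s0 t) - y2) * B [:: j] (P s0 t))).
    move=> td; have Us := UP s0 t s0d td.
    exact: (is_derive_sum_sqr y1 y2 (jet_line_derive [::] HA Us) (jet_line_derive [::] HB Us)).
  have t0in : t0 \in `]- d, d[ by rewrite in_itv /= -ltr_norml.
  have [_ e1] := derive1_at_min dd (fun s sd => @ex_derive _ _ _ _ _ _ _ (der s (inI s sd))) t0in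
    (fun s sd => wmin s0 s s0d (inI s sd)).
  have [_ e2] := der t0 t0d; move: e1; rewrite e2.
  by move=> /eqP; rewrite mulf_eq0 pnatr_eq0 /= => /eqP.
have [[_ NP] [[/= a1 a2] [/= b1 b2]]] := He _ (inb _ _ s0d t0d).
rewrite !subr0 in a2 b1.
move: a1 a2 b1 b2 crit_i crit_j; rewrite -/s0 -/t0.
set a := A [:: i] _; set b := B [:: i] _; set c := A [:: j] _; set e' := B [:: j] _.
rewrite !ltr_norml => /andP[a1 _] /andP[c1 c2] /andP[b1 b2] /andP[e1 _] ci cj.
have det : 0 < a * e' - b * c by nra.
have x0 : x = 0.
  have : x * (a * e' - b * c) = e' * (x * a + y * b) - b * (x * c + y * e') by ring.
  by rewrite ci cj !mulr0 subr0 => /eqP; rewrite mulf_eq0 (gt_eqF det) orbF => /eqP.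
have y0 : y = 0.
  have : y * (a * e' - b * c) = a * (x * c + y * e') - c * (x * a + y * b) by ring.
  by rewrite ci cj !mulr0 subr0 => /eqP; rewrite mulf_eq0 (gt_eqF det) orbF => /eqP.
exists (P s0 t0); split => //; apply/eqP; rewrite -subr_eq0; apply/eqP.
  exact: x0.
exact: y0.
Qed.

Lemma lin_comb2_jet U A B (a b : R) : analytic_jet U A -> analytic_jet U B ->
  analytic_jet U (fun s x => a * A s x + b * B s x).
Proof.
move=> HA HB.
pose G (i : 'I_2) := if i == ord0 then A else B.
have HG i : analytic_jet U (G i) by rewrite /G; case: ifP.
have := lin_comb_jet (fun i : 'I_2 => if i == ord0 then a else b) 0 HG.
rewrite (_ : (fun s x => _) = fun s x => a * A s x + b * B s x)//.
apply/funext => s; apply/funext => x.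
by rewrite !big_ord_recl big_ord0 /G /=; case: s => *; rewrite !addr0.
Qed.

(** Composing with the inverse of the Jacobian matrix at u0 reduces to
    [jet_pair_open_normal]. *)
Lemma jet_pair_open U A B i j u0 (N : set 'rV[R]_k) :
  open U -> analytic_jet U A -> analytic_jet U B -> U u0 ->
  A [:: i] u0 * B [:: j] u0 - A [:: j] u0 * B [:: i] u0 != 0 ->
  nbhs u0 N ->
  exists2 eps, 0 < eps & forall y1 y2, `|y1 - A [::] u0| < eps ->
    `|y2 - B [::] u0| < eps -> exists u, [/\ N u, A [::] u = y1 & B [::] u = y2].
Proof.
move=> Uop HA HB Uu0; set a := A [:: i] u0; set b := A [:: j] u0.
set c := B [:: i] u0; set d := B [:: j] u0; set D := a * d - b * c => D0 Nu0.
have HA' := lin_comb2_jet (d / D) (- b / D) HA HB.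
have HB' := lin_comb2_jet (- c / D) (a / D) HA HB.
have [||||e e0 He] := jet_pair_open_normal (i := i) (j := j) Uop HA' HB' Uu0 _ _ _ _ Nu0.
- by rewrite -/a -/c /D; field.
- by rewrite -/b -/d /D; field.
- by rewrite -/a -/c /D; field.
- by rewrite -/b -/d /D; field.
pose M := `|a| + `|b| + `|c| + `|d| + 1.
have M0 : 0 < M by rewrite /M; do ![apply: ltr_wpDl => //; rewrite ?addr_ge0//].
have Dn : 0 < `|D| by rewrite normr_gt0.
exists (e * `|D| / M); first by rewrite divr_gt0// mulr_gt0.
move=> y1 y2 h1 h2.
have bnd p q : `|p| + `|q| <= M - 1 ->
    `|(p / D * y1 + q / D * y2) - (p / D * A [::] u0 + q / D * B [::] u0)| < e.
  move=> pq; have -> : (p / D * y1 + q / D * y2) - (p / D * A [::] u0 + q / D * B [::] u0) =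
    (p * (y1 - A [::] u0) + q * (y2 - B [::] u0)) / D by ring.
  rewrite normrM normfV ltr_pdivrMr//.
  apply: (@le_lt_trans _ _ ((M - 1) * (e * `|D| / M))).
    apply: le_trans (ler_normD _ _) _; rewrite !normrM.
    have em : 0 <= e * `|D| / M by rewrite ltW// divr_gt0// mulr_gt0.
    apply: le_trans (ler_wpM2r em pq); rewrite mulrDl.
    by rewrite lerD// ler_wpM2l// ltW.
  rewrite mulrA ltr_pdivrMr// mulrC ltr_pM2l ?mulr_gt0//.
  by lra.
have [||u [Nu uA uB]] := He (d / D * y1 + - b / D * y2) (- c / D * y1 + a / D * y2).
- by apply: bnd; rewrite normrN /M; have := normr_ge0 a; have := normr_ge0 c; lra.
- by apply: bnd; rewrite normrN /M; have := normr_ge0 b; have := normr_ge0 d; lra.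
have DE : D = a * d - b * c by [].
exists u; split => //.
- have -> : A [::] u = a * (d / D * A [::] u + - b / D * B [::] u) +
      b * (- c / D * A [::] u + a / D * B [::] u).
    by transitivity ((a * d - b * c) / D * A [::] u); [rewrite -DE divff// mul1r|ring].
  rewrite uA uB.
  by transitivity ((a * d - b * c) / D * y1); [ring|rewrite -DE divff// mul1r].
- have -> : B [::] u = c * (d / D * A [::] u + - b / D * B [::] u) +
      d * (- c / D * A [::] u + a / D * B [::] u).
    by transitivity ((a * d - b * c) / D * B [::] u); [rewrite -DE divff// mul1r|ring].
  rewrite uA uB.
  by transitivity ((a * d - b * c) / D * y2); [ring|rewrite -DE divff// mul1r].
Qed.

End open_pair.

(** * Charts and regular pairs of coordinates *)

Section charts.
Context (R : realType) (n k : nat).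
Implicit Types (S : set 'rV[R]_n) (U : set 'rV[R]_k) (f : 'rV[R]_k -> 'rV[R]_n).

Lemma differentiable_coords f (u : 'rV[R]_k) :
  (forall j, differentiable (fun x => f x 0 j) u) -> differentiable f u.
Proof.
move=> df; have -> : f = \sum_(j < n) (fun x => f x 0 j *: ('e_j : 'rV[R]_n)).
  by apply/funext => x; rewrite fct_sumE; exact: row_sum_delta.
by apply: differentiable_sum => j; apply: differentiableZl.
Qed.

Definition partial f (i : 'I_k) (j : 'I_n) (u : 'rV[R]_k) : R :=
  pderivs [:: i] (fun x => f x 0 j) u.

Lemma jacobian_partial f u i j : differentiable f u -> ('J f u) i j = partial f i j u.
Proof.
move=> df; have e := deriveEjacobian 'e_i df.
rewrite -rowE in e; have -> : ('J f u) i j = row i ('J f u) 0 j by rewrite [RHS]mxE.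
rewrite -e derive_mx; last exact: diff_derivable.
by rewrite mxE.
Qed.

(** A local parametrization of S by U.  The homeomorphism property enters as
    [chart_embedding]: the image of a neighbourhood of u is a neighbourhood of
    f u in S. *)
Record chart S U f : Prop := {
  chart_open : open U;
  chart_sub : forall u, U u -> S (f u);
  chart_differentiable : forall u, U u -> differentiable f u;
  chart_embedding : forall u O, U u -> nbhs u O ->
    \forall z \near f u, S z -> exists v, [/\ U v, O v & f v = z];
  chart_jet : forall j, analytic_jet U (fun s => pderivs s (fun x => f x 0 j));
  chart_rank : forall u, U u -> \rank ('J f u) = k }.

Lemma chart_continuous S U f u : chart S U f -> U u -> f v @[v --> u] --> f u.
Proof.
by move=> C Uu; exact: (differentiable_continuous (chart_differentiable C Uu)).
Qed.

(** The set V with V meeting S in f(U) is a neighbourhood of xi only, so U is cut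
    down to the points whose image is interior to V. *)
Lemma submanifold_chart S xi : analytic_submanifold k S -> S xi ->
  exists U f u, [/\ chart S U f, U u & f u = xi].
Proof.
move=> [_ HS] /[dup] Sxi /HS[V [U [f [Vxi Uop [finj fan frank] [fcont [g [gf gcont]]] VS]]]].
have [u0 Uu0 fu0] : (f @` U) xi by rewrite -VS; split => //; exact: nbhs_singleton.
pose U0 := U `&` [set u | nbhs (f u) V].
have df u : U u -> differentiable f u.
  move=> Uu; apply: differentiable_coords => j.
  by have [sm _] := fan j; exact: (sm [::] u Uu).
have U0op : open U0.
  rewrite openE => u [Uu Vfu]; apply: filterI.
    by exact: open_nbhs_nbhs.
  have /= h := differentiable_continuous (df u Uu) (nbhs_interior Vfu).
  exact: h.
exists U0, f, u0; split => //; last by split => //=; rewrite fu0.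
split => //.
- move=> u [Uu Vfu]; have : (V `&` S) (f u) by rewrite VS; exists u.
  by case.
- by move=> u [Uu _]; exact: df.
- move=> u O [Uu Vfu] Ou.
  have fUu : (f @` U) (f u) by exists u.
  have := (subspace_continuousP (f @` U) g).1 gcont (f u) fUu.
  rewrite (gf u); last by rewrite inE.
  move=> /(_ O Ou) /= h'.
  have h : \forall z \near f u, (f @` U) z -> O (g z) by exact: h'.
  have Vint : \forall z \near f u, V° z by exact: nbhs_interior Vfu.
  apply: filterS2 h Vint => z h Vz Sz.
  have [v Uv fv] : (f @` U) z by rewrite -VS; split => //; exact: interior_subset Vz.
  exists v; split => //; first by split => //=; rewrite fv.
  have : O (g z) by apply: h; exists v.
  by rewrite -fv gf// inE.
- move=> j; apply: pderivs_jet; have [sm an] := fan j.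
  split=> [s x [Ux _]|x [Ux _]]; first exact: sm.
  exact: an.
- by move=> u [Uu _]; exact: frank.
Qed.

(** Near a point of S, S contains the image of a compact ball of the chart, which
    is closed and is a neighbourhood in S; so no other limit points of S occur
    nearby. *)
Lemma submanifold_locally_closed S : analytic_submanifold k S -> locally_closed S.
Proof.
move=> HS.
exists [set z | closure S z -> S z]°; first exact: open_interior.
apply/seteqP; split=> [xi Sxi|xi [clS /interior_subset]]; last exact.
split; first exact: subset_closure.
have [U [f [u [C Uu fu]]]] := submanifold_chart HS Sxi.
have /nbhs_ballP[e /= e0 He] : nbhs u U by exact: open_nbhs_nbhs (conj (chart_open C) Uu).
have e2 : 0 < e / 2 by rewrite divr_gt0.
pose K := [set z | `|z - u| <= e / 2].
have KU : K `<=` U.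
  by move=> z zK; apply: He; rewrite -ball_normE /= distrC; apply: le_lt_trans zK _; lra.
have Kn : nbhs u K.
  apply/nbhs_ballP; exists (e / 2) => //= z; rewrite -ball_normE /= distrC; exact: ltW.
have fKc : closed (f @` K).
  apply: compact_closed; first exact: norm_hausdorff.
  apply: continuous_compact; last exact: closed_ball_rV_compact.
  apply: continuous_in_subspaceT => z /set_mem /KU Uz; exact: (chart_continuous C Uz).
have := chart_embedding C Uu Kn; rewrite fu => h.
have h2 : \forall z \near xi, closure S z -> (f @` K) z.
  apply: filterS (nbhs_interior h) => z hz clSz; apply: fKc => B Bz.
  have [y [Sy [hy By]]] := clSz _ (filterI hz Bz).
  by exists y; split => //; have [v [Uv Kv fv]] := hy Sy; exists v.
apply: filterS h2 => z hz /hz[v Kv <-].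
by apply: (chart_sub C); exact: KU.
Qed.


(** The jet of u |-> q.f(u) - m_0, where m = (m_0, q). *)
Definition form_jet f (m : 'rV[int]_n.+1) (s : seq 'I_k) (u : 'rV[R]_k) : R :=
  \sum_j (normal_part m 0 j)%:~R * pderivs s (fun x => f x 0 j) u
  + (if s is [::] then - (m 0 ord0)%:~R else 0).

Lemma form_jetP S U f m : chart S U f -> analytic_jet U (form_jet f m).
Proof. by move=> C; apply: lin_comb_jet => j; exact: (chart_jet C). Qed.

Lemma form_jet_eq0 f m u : form_jet f m [::] u = 0 <-> hyperplane m (f u).
Proof.
rewrite /form_jet /hyperplane /= /dotz; split=> [/eqP|->]; last by rewrite subrr.
by rewrite subr_eq0 => /eqP.
Qed.

Lemma jet_locally0 U G v : open U -> analytic_jet U G -> U v ->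
  (\forall u \near v, G [::] u = 0) -> forall s, G s v = 0.
Proof.
move=> Uop HG Uv G0 s.
suff : \forall u \near v, G s u = 0 by exact: nbhs_singleton.
elim: s => [//|j s IH].
have Un : \forall u \near v, U u by exact: open_nbhs_nbhs.
have IH' : \forall u \near v, [set w | G s w = 0]° u by exact: nbhs_interior IH.
apply: filterS2 IH' Un => u Gu Uu.
rewrite -(jet_derive HG)//.
have : {near u, G s =1 cst 0} by exact: Gu.
by move=> /near_eq_derive ->; rewrite derive_cst.
Qed.

(** The identity theorem on S: the set of points near which S lies in the
    hyperplane is open in S, and closed in S because at a limit point all the
    derivatives of the form vanish, by continuity, hence so does the form. *)
Lemma hyperplane_not_locally_containing S m : connected S -> analytic_submanifold k S ->
  ~ S `<=` hyperplane m ->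
  forall x, S x -> ~ \forall z \near x, S z -> hyperplane m z.
Proof.
move=> Sconn HS Sm x0 Sx0 E0; apply: Sm.
pose E : set 'rV[R]_n := S `&` [set z | S z -> hyperplane m z]°.
suff <- : E = S by move=> z [Sz /interior_subset]; exact.
apply: Sconn; first by exists x0.
  by exists [set z | S z -> hyperplane m z]° => //; exact: open_interior.
exists (closure E); first exact: closed_closure.
apply/seteqP; split=> [x Ex|x [Sx clE]]; first by split; [case: Ex|exact: subset_closure].
split=> //.
have [U [f [u [C Uu fu]]]] := submanifold_chart HS Sx.
have HG := form_jetP m C.
have flat s : form_jet f m s u = 0.
  apply: contrapT => /eqP Gs.
  have := chart_embedding C Uu (jet_neq0_near HG Uu Gs); rewrite fu => /clE.
  move=> [z [[Sz Ez] /(_ Sz)[v [Uv Gv fv]]]].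
  have : \forall w \near v, form_jet f m [::] w = 0.
    have Uw : \forall w \near v, U w by exact: open_nbhs_nbhs (conj (chart_open C) Uv).
    have Ew : \forall w \near v, S (f w) -> hyperplane m (f w).
      have Ev : nbhs (f v) [set z | S z -> hyperplane m z] by rewrite fv; exact: Ez.
      exact: (chart_continuous C Uv Ev).
    by apply: filterS2 Uw Ew => w Uw h; apply/form_jet_eq0/h/(chart_sub C).
  by move=> /(jet_locally0 (chart_open C) HG Uv)/(_ s)/eqP; apply/negP.
have := chart_embedding C Uu (jet_flat_near0 HG Uu flat); rewrite fu.
apply: filterS => z h Sz; have [v [Uv Gv <-]] := h Sz.
exact/form_jet_eq0.
Qed.

Definition minor f i j (p : 'I_n * 'I_n) u : R :=
  partial f i p.1 u * partial f j p.2 u - partial f j p.1 u * partial f i p.2 u.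

(** The points of S near which the coordinates p.1 and p.2 form a submersion of S
    to the plane. *)
Definition regular_pair S p : set 'rV[R]_n :=
  [set x | exists U f u (i j : 'I_k), [/\ chart S U f, U u, f u = x & minor f i j p u != 0]].

Lemma regular_pair_sub S p : regular_pair S p `<=` S.
Proof. by move=> x [U [f [u [i [j [C Uu <- _]]]]]]; exact: (chart_sub C). Qed.

Lemma regular_pair_open S p x : regular_pair S p x ->
  \forall z \near x, S z -> regular_pair S p z.
Proof.
move=> [U [f [u [i [j [C Uu fu mn]]]]]].
have near_m : \forall v \near u, minor f i j p v != 0.
  have cv i' j' : partial f i' j' v @[v --> u] --> partial f i' j' u.
    have h := @jet_continuous R k U _ [:: i'] u (chart_jet C j') Uu; exact: h.
  have cm : minor f i j p v @[v --> u] --> minor f i j p u.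
    apply: (@cvgB R R^o _ (nbhs u) _).
      by apply: (@cvgM R _ (nbhs u) _); exact: cv.
    by apply: (@cvgM R _ (nbhs u) _); exact: cv.
  exact: (@cvgr_neq0 R R^o _ (nbhs u) _ _ _ cm mn).
have := chart_embedding C Uu near_m; rewrite fu; apply: filterS => z h Sz.
by have [v [Uv mv fv]] := h Sz; exists U, f, v, i, j.
Qed.

(** The first two rows of the Jacobian matrix are independent, so some 2 by 2
    minor of them is nonzero: otherwise, if the entry (i0, a) is nonzero, row i1
    is proportional to row i0. *)
Lemma regular_pair_exists S x : (2 <= k)%N -> analytic_submanifold k S -> S x ->
  exists p, regular_pair S p x.
Proof.
move=> k2 HS Sx; have [U [f [u [C Uu fu]]]] := submanifold_chart HS Sx.
pose i0 : 'I_k := Ordinal (ltnW k2); pose i1 : 'I_k := Ordinal k2.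
have Jfree : row_free ('J f u) by rewrite /row_free (chart_rank C Uu).
have JE i j : ('J f u) i j = partial f i j u.
  by apply: jacobian_partial; exact: (chart_differentiable C Uu).
move: ('J f u) Jfree JE => J Jfree JE.
have [a Ja] : exists a, partial f i0 a u != 0.
  apply: contrapT => none.
  have : ('e_i0 : 'rV[R]_k) *m J = 0.
    rewrite -rowE; apply/rowP => a; rewrite [LHS]mxE [RHS]mxE JE.
    by apply: contrapT => /eqP h; apply: none; exists a.
  move=> /eqP; rewrite mulmx_free_eq0// => /eqP/rowP/(_ i0).
  by rewrite !mxE !eqxx => /eqP; rewrite oner_eq0.
apply: contrapT => none.
have : (partial f i0 a u *: 'e_i1 - partial f i1 a u *: 'e_i0 : 'rV[R]_k) *m J = 0.
  rewrite mulmxBl -!scalemxAl -!rowE; apply/rowP => b.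
  rewrite !mxE !JE; apply: contrapT => /eqP h; apply: none.
  exists (a, b), U, f, u, i0, i1; split => //; exact: h.
move=> /eqP; rewrite mulmx_free_eq0// => /eqP/rowP/(_ i1).
rewrite !mxE !eqxx /= mulr1 mulr0 subr0 => /eqP; exact/negP.
Qed.

Lemma regular_pair_values S p x (O : set 'rV[R]_n) : regular_pair S p x -> nbhs x O ->
  exists2 eps, 0 < eps & forall y1 y2, `|y1 - x 0 p.1| < eps -> `|y2 - x 0 p.2| < eps ->
    exists z, [/\ S z, O z, z 0 p.1 = y1 & z 0 p.2 = y2].
Proof.
move=> [U [f [u [i [j [C Uu <- mn]]]]]] Ou.
have UN : nbhs u (U `&` f @^-1` O).
  apply: filterI; first exact: open_nbhs_nbhs (conj (chart_open C) Uu).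
  exact: (chart_continuous C Uu).
have [e e0 He] := jet_pair_open (chart_open C) (chart_jet C p.1) (chart_jet C p.2) Uu mn UN.
exists e => // y1 y2 h1 h2; have [v [[Uv Ov] <- <-]] := He _ _ h1 h2.
by exists (f v); split => //; exact: (chart_sub C).
Qed.

(** The hyperplane x_(p.2) + al x_(p.1) = c, pullback of a line of the plane. *)
Definition line_vector (p : 'I_n * 'I_n) (al c : int) : 'rV[int]_n.+1 :=
  \row_i (if unlift ord0 i is Some j then
            if j == p.2 then 1 else if j == p.1 then al else 0
          else c).

Lemma line_vector_normal p al c j : normal_part (line_vector p al c) 0 j =
  if j == p.2 then 1 else if j == p.1 then al else 0.
Proof. by rewrite !mxE liftK. Qed.

Lemma line_vector_const p al c : line_vector p al c 0 ord0 = c.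
Proof. by rewrite mxE unlift_none. Qed.

Lemma line_vector_sum p al c (F : 'I_n -> R) : p.1 != p.2 ->
  \sum_j (normal_part (line_vector p al c) 0 j)%:~R * F j = F p.2 + al%:~R * F p.1.
Proof.
move=> p12; rewrite (bigD1 p.2)//= (bigD1 p.1)//= big1 => [|j /andP[j2 j1]].
  by rewrite !line_vector_normal !eqxx (negbTE p12) mul1r addr0.
by rewrite line_vector_normal (negbTE j1) (negbTE j2) mul0r.
Qed.

Lemma line_vector_hyperplane p al c (x : 'rV[R]_n) : p.1 != p.2 ->
  hyperplane (line_vector p al c) x <-> x 0 p.2 + al%:~R * x 0 p.1 = c%:~R.
Proof.
by move=> p12; rewrite /hyperplane /= /dotz line_vector_sum// line_vector_const.
Qed.

Lemma line_vector_primitive p al c : hyperplane_vector (line_vector p al c).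
Proof.
split; last first.
  apply/negP => /eqP/rowP/(_ p.2); rewrite line_vector_normal eqxx mxE.
  by move=> /eqP; rewrite oner_eq0.
apply/eqP; rewrite -dvdn1; apply: (biggcdn_inf (lift ord0 p.2)) => //.
by rewrite mxE liftK eqxx.
Qed.

Lemma line_vector_height p al c : p.1 != p.2 ->
  `|al%:~R| <= height R (line_vector p al c).
Proof.
move=> p12; rewrite /height /znorm; have := rV_coord_le_norm
  (map_mx intr (normal_part (line_vector p al c)) : 'rV[R]_n) p.1.
by rewrite mxE line_vector_normal eqxx (negbTE p12).
Qed.

Lemma regular_pair_neq S p x : regular_pair S p x -> p.1 != p.2.
Proof.
move=> [U [f [u [i [j [_ _ _]]]]]]; apply: contraNneq; rewrite /minor => ->.
by rewrite mulrC subrr.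
Qed.

(** Where the pair is regular, the equation of the line has nonzero gradient on
    S, so [jet_zero_set_local] applies to it and to the form of m. *)
Lemma regular_pair_isolates S p al c m x (O : set 'rV[R]_n) :
  regular_pair S p x -> hyperplane (line_vector p al c) x -> nbhs x O ->
  ~ (\forall z \near x, S z -> hyperplane m z) ->
  (forall z, O z -> S z -> hyperplane (line_vector p al c) z -> hyperplane m z) ->
  exists y, [/\ O y, S y, hyperplane (line_vector p al c) y &
    \forall z \near y, S z -> hyperplane m z -> hyperplane (line_vector p al c) z].
Proof.
move=> reg; have p12 := regular_pair_neq reg.
move: reg => [U [f [u [i [j [C Uu <- mn]]]]]] hx Ou nm Om.
have HH := form_jetP (line_vector p al c) C; have HG := form_jetP m C.
have Hd l : form_jet f (line_vector p al c) [:: l] u = partial f l p.2 u + al%:~R * partial f l p.1 u.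
  by rewrite /form_jet addr0 line_vector_sum.
have [l Hl] : exists l, form_jet f (line_vector p al c) [:: l] u != 0.
  apply: contrapT => none.
  have H0 l : partial f l p.2 u = - (al%:~R * partial f l p.1 u).
    apply/eqP; rewrite -addr_eq0 -Hd; apply/eqP.
    by apply: contrapT => /eqP h; apply: none; exists l.
  by move/eqP: mn; apply; rewrite /minor !H0; ring.
have nG : ~ (\forall v \near u, form_jet f m [::] v = 0).
  move=> G0; apply: nm.
  apply: filterS (chart_embedding C Uu G0) => z h Sz.
  by have [v [_ Gv <-]] := h Sz; exact/form_jet_eq0.
have UN : nbhs u (U `&` f @^-1` O).
  apply: filterI; first exact: open_nbhs_nbhs (conj (chart_open C) Uu).
  exact: (chart_continuous C Uu).
have [||v [[_ Ov] Uv Hv near_v]] := jet_zero_set_local (chart_open C) HH HG Uu _ Hl nG UN.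
- exact/form_jet_eq0.
- move=> v [Uv Ov] /form_jet_eq0 Hv; apply/form_jet_eq0; apply: Om => //.
  exact: (chart_sub C).
exists (f v); split => //; first exact: (chart_sub C).
  exact/form_jet_eq0.
apply: filterS (chart_embedding C Uv near_v) => z h Sz; have [w [Uw Gw <-]] := h Sz.
by move=> /form_jet_eq0/Gw/form_jet_eq0.
Qed.

End charts.

(** * The Khintchine system of an analytic submanifold *)

Section construction.
Context (R : realType) (n k : nat) (S : set 'rV[R]_n).
Hypothesis k_ge2 : (2 <= k)%N.
Hypothesis S_submanifold : analytic_submanifold k S.
Hypothesis S_connected : connected S.
Hypothesis S_not_in_hyperplane : forall m, hyperplane_vector m -> ~ S `<=` hyperplane m.

Let reg p := @regular_pair R n k S p.

(** The regular points of p that are not limits of regular points of an earlier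
    pair; this makes the regions disjoint while keeping their union dense. *)
Definition pair_region (p : 'I_n * 'I_n) : set 'rV[R]_n :=
  [set x | reg p x /\ forall q, (enum_rank q < enum_rank p)%N -> ~ closure (reg q) x].

Lemma pair_region_sub p : pair_region p `<=` S.
Proof. by move=> x [/regular_pair_sub]. Qed.

Lemma pair_region_open p x : pair_region p x -> \forall z \near x, S z -> pair_region p z.
Proof.
move=> [px far].
pose G (q : 'I_n * 'I_n) z := (enum_rank q < enum_rank p)%N -> ~ closure (reg q) z.
have A1 : \forall z \near x, forall q, G q z.
  apply: (@filter_forall _ _ G (nbhs x)) => q; rewrite /G.
  case: ltnP => [qp|_]; last by apply: (@nearW _ (nbhs x)).
  have : nbhs x (~` closure (reg q)).
    apply: open_nbhs_nbhs; split; last exact: far.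
    by apply: closed_openC; exact: closed_closure.
  by apply: filterS => z h _; exact: h.
by apply: filterS2 A1 (regular_pair_open px) => z h1 h2 Sz; split; [exact: h2|exact: h1].
Qed.

Lemma pair_region_disjoint p q x : pair_region p x -> pair_region q x -> p = q.
Proof.
move=> [px pf] [qx qf]; case: (ltngtP (enum_rank p) (enum_rank q)) => h.
- by exfalso; apply: (qf p h); exact: subset_closure.
- by exfalso; apply: (pf q h); exact: subset_closure.
- exact/enum_rank_inj/val_inj.
Qed.

(** In a given open set, take the first pair that is regular somewhere in it. *)
Lemma pair_region_dense x O : S x -> nbhs x O -> exists p z, pair_region p z /\ O° z.
Proof.
move=> Sx Ox.
have [p0 p0x] := regular_pair_exists k_ge2 S_submanifold Sx.
have O0x : O° x by exact: nbhs_singleton (nbhs_interior Ox).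
have ex : exists r, `[< exists p z, [/\ enum_rank p = r :> nat, reg p z & O° z] >].
  by exists (enum_rank p0); apply/asboolP; exists p0, x.
case: (ex_minnP ex) => r /asboolP[p [z [pr pz Oz]]] rmin.
exists p, z; split => //; split => // q qp clq.
have [y [qy Oy]] := clq _ (open_nbhs_nbhs (conj (@open_interior _ O) Oz)).
have := rmin (enum_rank q); rewrite leqNgt -pr qp => /(_ _)/negP; apply => //.
by apply/asboolP; exists q, y.
Qed.

Definition core (t : 'I_n * 'I_n * int * int) : set 'rV[R]_n :=
  [set x | pair_region t.1.1 x /\ hyperplane (line_vector t.1.1 t.1.2 t.2) x].

Definition piece t : set 'rV[R]_n := S `&` closure (core t).

Lemma core_sub_piece t : core t `<=` piece t.
Proof. by move=> x cx; split; [exact: pair_region_sub cx.1|exact: subset_closure]. Qed.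

Lemma piece_rel_closed t : rel_closed S (piece t).
Proof. by exists (closure (core t)) => //; exact: closed_closure. Qed.

Lemma piece_hyperplane t : piece t `<=` hyperplane (line_vector t.1.1 t.1.2 t.2).
Proof.
move=> x [_ clx]; apply: hyperplane_closed => B /clx[y [[_ hy] By]].
by exists y.
Qed.

(** On S the pair of coordinates takes all nearby values; those on the line form a
    segment, parametrized by the first coordinate. *)
Lemma core_crossing t x O : core t x -> nbhs x O ->
  exists2 eps, 0 < eps & forall h, `|h| < eps -> exists z,
    [/\ core t z, O z & z 0 t.1.1.1 = x 0 t.1.1.1 + h].
Proof.
move=> [px hx] Ox; have [regx _] := px; have p12 := regular_pair_neq regx.
have ON : nbhs x (O `&` [set z | S z -> pair_region t.1.1 z]).
  by apply: filterI => //; exact: pair_region_open.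
have [e e0 He] := regular_pair_values regx ON.
have M0 : 0 < 1 + `|t.1.2%:~R| :> R by rewrite ltr_wpDr.
exists (e / (1 + `|t.1.2%:~R|)); first by rewrite divr_gt0.
move=> h; rewrite ltr_pdivlMr// mulrDr mulr1 => he.
have [||z [Sz [Oz pz] z1 z2]] := He (x 0 t.1.1.1 + h) (x 0 t.1.1.2 - t.1.2%:~R * h).
- rewrite addrAC subrr add0r; apply: le_lt_trans he; by rewrite lerDl mulr_ge0.
- rewrite addrAC subrr add0r normrN normrM mulrC; apply: le_lt_trans he.
  by rewrite lerDr.
exists z; split => //; split; first exact: pz.
apply/line_vector_hyperplane => //; rewrite z1 z2.
by move/line_vector_hyperplane: hx => /(_ p12) <-; ring.
Qed.

(** The set Z contains no nonempty relatively open part of the cut [core t]. *)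
Definition thin t (Z : set 'rV[R]_n) := forall x O, core t x -> nbhs x O ->
  exists y, [/\ O y, core t y & ~ Z y].

(** Pieces of different regions meet only in boundary points of the regions; within
    a region, two distinct lines share at most one value of the coordinate. *)
Lemma piece_thin t t' : t <> t' -> thin t (piece t').
Proof.
move=> tt' x O cx Ox.
have [|ptx] := pselect (piece t' x); last by exists x; split => //; exact: nbhs_singleton.
move=> ptx; have [px hx] := cx; have [regx _] := px.
have p12 := regular_pair_neq regx.
have [z hz pz] : exists2 z, pair_region t.1.1 z & core t' z.
  have [_ /(_ _ (pair_region_open px))[z [cz Oz]]] := ptx.
  by exists z => //; apply: Oz; exact: pair_region_sub cz.1.
have pp : t.1.1 = t'.1.1 by exact: pair_region_disjoint hz pz.1.
have [e e0 He] := core_crossing cx Ox.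
have [|y [cy Oy y1]] := He (e / 2); first by rewrite ger0_norm ?divr_ge0 ?ltW//; lra.
exists y; split => // /piece_hyperplane hy'.
have /(line_vector_hyperplane _ _ _ p12) xl := hx.
have /(line_vector_hyperplane _ _ _ p12) yl := cy.2.
move/piece_hyperplane: ptx; rewrite -pp => /(line_vector_hyperplane _ _ _ p12) xl'.
move: hy'; rewrite -pp => /(line_vector_hyperplane _ _ _ p12) yl'.
have al : t.1.2%:~R = t'.1.2%:~R :> R.
  have : (t.1.2%:~R - t'.1.2%:~R) * (y 0 t.1.1.1 - x 0 t.1.1.1) = 0 :> R.
    have -> : forall a b c d : R, (a - b) * (c - d) = (a * c - b * c) - (a * d - b * d).
      by move=> *; ring.
    by lra.
  rewrite y1 addrAC subrr add0r => /eqP; rewrite mulf_eq0 subr_eq0.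
  by rewrite (gt_eqF (_ : 0 < e / 2)) ?divr_gt0// orbF => /eqP.
have cc : t.2%:~R = t'.2%:~R :> R by rewrite -xl -xl' al.
have e1 : t.1.2 = t'.1.2 by apply/eqP; rewrite -(eqr_int R) al.
have e2 : t.2 = t'.2 by apply/eqP; rewrite -(eqr_int R) cc.
apply: tt'; rewrite [t]surjective_pairing [t.1]surjective_pairing pp e1 e2.
by rewrite -!surjective_pairing.
Qed.

Definition I_set : set nat := [set i | exists2 t : ('I_n * 'I_n * int * int)%type, i = pickle t & core t !=set0].
Definition L_fam i : set 'rV[R]_n :=
  if @unpickle ('I_n * 'I_n * int * int)%type i is Some t then piece t else set0.
Definition m_fam i : 'rV[int]_n.+1 :=
  if @unpickle ('I_n * 'I_n * int * int)%type i is Some t then line_vector t.1.1 t.1.2 t.2 else 0.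

(** The section of S by the hyperplane, without the relative interiors of the
    pieces lying in it. *)
Definition residue (M : 'rV[int]_n.+1) : set 'rV[R]_n :=
  [set x | [/\ S x, hyperplane M x &
    ~ exists i, I_set i /\ \forall z \near x, S z -> hyperplane M z -> L_fam i z]].

Lemma I_setP t : core t !=set0 -> [/\ I_set (pickle t), L_fam (pickle t) = piece t &
  m_fam (pickle t) = line_vector t.1.1 t.1.2 t.2].
Proof.
by move=> t0; rewrite /L_fam /m_fam pickleK; split => //; exists t => //; rewrite pickleK.
Qed.

Lemma residue_rel_closed M : rel_closed S (residue M).
Proof.
exists (hyperplane M `&` ~` \bigcup_(i in I_set) [set z | S z -> hyperplane M z -> L_fam i z]°).
  apply: closedI; first exact: hyperplane_closed.
  by apply: open_closedC; apply: bigcup_open => i _; exact: open_interior.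
apply/seteqP; split=> x.
  by move=> [Sx Mx no]; split => //; split => // -[i Ii ix]; apply: no; exists i.
by move=> [Sx [Mx no]]; split => // -[i [Ii ix]]; apply: no; exists i.
Qed.

Lemma residue_cover M x : S x -> hyperplane M x ->
  (\bigcup_(i in I_set) L_fam i `|` residue M) x.
Proof.
move=> Sx Mx; have [[i [Ii h]]|no] := pselect (exists i, I_set i /\
    \forall z \near x, S z -> hyperplane M z -> L_fam i z); last by right.
by left; exists i => //; exact: (nbhs_singleton h).
Qed.

(** An open part of a cut contained in the residue would lie in the hyperplane of
    M; by [regular_pair_isolates] the section by M coincides with the cut near
    one of its points, and such a point does not belong to the residue. *)
Lemma residue_thin t M : hyperplane_vector M -> thin t (residue M).
Proof.
move=> hM x O cx Ox; apply: contrapT => none.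
have [px hx] := cx; have [regx _] := px.
have ON : nbhs x (O `&` [set z | S z -> pair_region t.1.1 z]).
  by apply: filterI => //; exact: pair_region_open.
have [||y [[Oy py] Sy hy near_y]] := regular_pair_isolates regx hx ON (m := M).
- apply: (hyperplane_not_locally_containing S_connected S_submanifold) => //.
    exact: S_not_in_hyperplane.
  exact: pair_region_sub px.
- move=> z [Oz pz] Sz hz; apply: contrapT => nMz; apply: none; exists z; split => //.
    by split => //; exact: pz.
  by case.
have cy : core t y by split => //; exact: py.
apply: none; exists y; split => // -[_ _ no]; apply: no.
have [It LE _] := I_setP (ex_intro _ y cy : core t !=set0).
exists (pickle t); split => //; rewrite LE.
apply: filterS2 (pair_region_open (py Sy)) near_y => z pz hz Sz Mz.
by apply: core_sub_piece; split; [exact: pz|exact: hz].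
Qed.

Definition residue_fam (j : nat) : set 'rV[R]_n :=
  if @unpickle 'rV[int]_n.+1 j is Some M then residue M else set0.

Definition J_valid : set nat := [set j | (exists2 M, @unpickle 'rV[int]_n.+1 j = Some M &
  hyperplane_vector M) /\ forall i, I_set i -> L_fam i <> residue_fam j].

(** Different hyperplanes may have the same residue, and a residue could be one of
    the pieces; to keep the families distinct and disjoint, only the first index
    of each residue is kept, and no index of a piece. *)
Definition J_set : set nat := [set j | J_valid j /\
  forall j', J_valid j' -> residue_fam j' = residue_fam j -> (j <= j')%N].

Lemma thin_avoid_seq t x O (Zs : seq (set 'rV[R]_n)) :
  (forall i, (i < size Zs)%N -> thin t (nth set0 Zs i) /\ rel_closed S (nth set0 Zs i)) ->
  core t x -> nbhs x O ->
  exists y, [/\ O y, core t y & forall i, (i < size Zs)%N -> ~ nth set0 Zs i y].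
Proof.
elim: Zs x O => [|Z Zs IH] x O HZ cx Ox.
  by exists x; split => //; exact: nbhs_singleton.
have [y [Oy cy nZy]] := (HZ 0%N isT).1 x _ cx (nbhs_interior Ox).
have near_y := near_rel_closed (HZ 0%N isT).2 (pair_region_sub cy.1) nZy.
have [|z [[Oz nz] cz av]] := IH y (O `&` [set z | S z -> ~ Z z]) (fun i h => HZ i.+1 h) cy.
  by apply: filterI => //; exact: Oy.
exists z; split => // -[|i] h /=; last exact: av.
by apply: nz; exact: pair_region_sub cz.1.
Qed.

Lemma thin_escape t (A : set (set 'rV[R]_n)) x O : finite_set A ->
  (forall Z, A Z -> thin t Z /\ rel_closed S Z) -> piece t x -> nbhs x O ->
  exists y, [/\ O y, core t y & forall Z, A Z -> ~ Z y].
Proof.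
move=> /finite_seqP[Zs AE] HA [Sx clx] Ox.
have [y [cy Oy]] := clx _ (nbhs_interior Ox).
have mem i : (i < size Zs)%N -> A (nth set0 Zs i).
  by move=> h; rewrite AE /=; exact: mem_nth.
have [z [Oz cz av]] := thin_avoid_seq (fun i h => HA _ (mem i h)) cy Oy.
exists z; split => // Z; rewrite AE /= => /(nthP set0)[i h <-]; exact: av.
Qed.

Lemma L_rel_closed i : I_set i -> rel_closed S (L_fam i).
Proof.
by move=> [t -> t0]; have [_ -> _] := I_setP t0; exact: piece_rel_closed.
Qed.

Lemma residue_fam_rel_closed j : J_set j -> rel_closed S (residue_fam j).
Proof. by move=> [[[M jM _] _] _]; rewrite /residue_fam jM; exact: residue_rel_closed. Qed.

Lemma rel_closed_contains (X Y : set 'rV[R]_n) : rel_closed S X -> Y `<=` X -> rel_closure S Y `<=` X.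
Proof.
move=> [C Ccl ->] YX x [Sx clx]; split => //; apply: Ccl => B Bx.
by have [y [Yy By]] := clx B Bx; exists y; split => //; have [] := YX y Yy.
Qed.

(** Taking c the integer part of N x + b leaves an error below 1/N. *)
Lemma large_denominator (eps x b T : R) : 0 < eps ->
  exists (N : nat) (c : int), [/\ T < N%:R, 0 < N%:R :> R &
    `|(c%:~R - b) / N%:R - x| < eps].
Proof.
move=> e0; pose M := Num.max T 0 + eps^-1.
have M0 : 0 <= M by rewrite addr_ge0 ?invr_ge0 ?(ltW e0)// le_max lexx orbT.
have /andP[_ MN] := truncn_itv M0.
have TM : T <= Num.max T 0 by rewrite le_max lexx.
have T0 : 0 <= Num.max T 0 by rewrite le_max lexx orbT.
have ei : 0 < eps^-1 by rewrite invr_gt0.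
have N0 : 0 < (Num.truncn M).+1%:R :> R by rewrite ltr0n.
move: MN N0; set N := (Num.truncn M).+1 => MN N0.
exists N, (Num.floor (N%:R * x + b)); split => //.
  by apply: le_lt_trans MN; rewrite /M; lra.
set c := Num.floor _.
have -> : (c%:~R - b) / N%:R - x = - (N%:R * x + b - c%:~R) / N%:R.
  by field; rewrite gt_eqF.
rewrite normrM normfV (ger0_norm (ltW N0)) ltr_pdivrMr// normrN.
have /andP[f0 f1] := frac_bounds (N%:R * x + b); rewrite ger0_norm//; apply: lt_trans f1 _.
rewrite -ltr_pdivrMl// mulr1; apply: le_lt_trans MN; rewrite /M; lra.
Qed.

(** The line of slope al + N with constant c + j crosses the line of slope al and
    constant c where the first coordinate is j/N; such rationals are dense for N
    large. *)
Lemma core_dense_crossing t x O (T : R) : core t x -> nbhs x O ->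
  exists t' y, [/\ core t y, core t' y, O y & T < height R (line_vector t'.1.1 t'.1.2 t'.2)].
Proof.
move=> cx Ox; have [px hx] := cx; have p12 := regular_pair_neq px.1.
have [e e0 He] := core_crossing cx Ox.
have [N [j [NT N0 Nj]]] := large_denominator (x 0 t.1.1.1) 0 (T + `|t.1.2%:~R|) e0.
have [y [cy Oy ya]] := He _ Nj.
exists (t.1.1, t.1.2 + N%:Z, t.2 + j), y; split => //.
  split; first exact: cy.1.
  apply/line_vector_hyperplane => //=.
  have /(line_vector_hyperplane _ _ _ p12) yl := cy.2.
  have -> : y 0 t.1.1.1 = j%:~R / N%:R by rewrite ya; ring.
  have {}yl : t.2%:~R = y 0 t.1.1.2 + t.1.2%:~R * (j%:~R / N%:R).
    by rewrite -yl ya; ring.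
  by rewrite !intrD -pmulrn yl; field; rewrite gt_eqF.
apply: lt_le_trans (line_vector_height _ _ _ _) => //=.
rewrite intrD -pmulrn; have := ler_normB (t.1.2%:~R + N%:R : R) t.1.2%:~R.
by rewrite addrAC subrr add0r (ger0_norm (ltW N0)); lra.
Qed.

(** Moving the first coordinate by less than 1/N makes z_b + N z_a an integer. *)
Lemma cores_dense x O : S x -> nbhs x O -> exists t y, core t y /\ O y.
Proof.
move=> Sx Ox; have [p [z [pz Oz]]] := pair_region_dense Sx Ox.
have p12 := regular_pair_neq pz.1.
have ON : nbhs z (O `&` [set w | S w -> pair_region p w]).
  by apply: filterI; [exact: Oz|exact: pair_region_open].
have [e e0 He] := regular_pair_values pz.1 ON.
have [N [c [_ N0 Nc]]] := large_denominator (z 0 p.1) (z 0 p.2) 0 e0.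
have [|y [Sy [Oy py] y1 y2]] := He _ (z 0 p.2) Nc; first by rewrite subrr normr0.
exists (p, N%:Z, c), y; split => //; split; first exact: py.
apply/line_vector_hyperplane => //=.
by rewrite y1 y2 -pmulrn; field; rewrite gt_eqF.
Qed.

Lemma L_fam_residue_disjoint i j : I_set i -> J_set j -> L_fam i <> residue_fam j.
Proof. by move=> Ii [[_ h] _]; exact: h. Qed.

Theorem Khintchine_system_exists :
  Khintchine_system S I_set J_set L_fam residue_fam m_fam.
Proof.
have L_thin t i : I_set i -> i <> pickle t -> thin t (L_fam i).
  move=> [t' -> t'0] it; have [_ -> _] := I_setP t'0.
  by apply: piece_thin => tt'; apply: it; rewrite tt'.
have R_thin t j : J_set j -> thin t (residue_fam j).
  by move=> [[[M jM hM] _] _]; rewrite /residue_fam jM; exact: residue_thin.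
split.
- move=> i i' /set_mem[t -> [x tx]] /set_mem[t' -> t'0] LL.
  congr pickle; apply: contrapT => tt'.
  have [_ Lt _] := I_setP (ex_intro _ x tx : core t !=set0); have [_ Lt' _] := I_setP t'0.
  have [y [_ ty]] := piece_thin tt' tx filterT.
  by apply; rewrite -Lt' -LL Lt; exact: core_sub_piece.
- move=> j j' /set_mem[Jj jmin] /set_mem[Jj' j'min] RR.
  by apply/eqP; rewrite eqn_leq jmin// j'min.
- exact: L_fam_residue_disjoint.
- exact: L_rel_closed.
- exact: residue_fam_rel_closed.
- move=> i [t -> t0]; have [_ -> ->] := I_setP t0; split; first exact: line_vector_primitive.
  exact: piece_hyperplane.
- move=> j [[[M jM hM] _] _]; exists M => //; rewrite /residue_fam jM.
  by move=> x [].
- apply/seteqP; split=> x.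
    move=> [[i Ii Lx]|[j Jj Rx]].
      move: Ii Lx => [t -> t0]; have [_ -> _] := I_setP t0 => tx; split; first by case: tx.
      exists (line_vector t.1.1 t.1.2 t.2); first exact: line_vector_primitive.
      by move=> _ ->; exact: piece_hyperplane.
    move: Jj Rx => [[[M jM hM] _] _]; rewrite /residue_fam jM => -[Sx Mx _]; split => //.
    by exists M => // _ ->.
  move=> [Sx [M hM /(_ x erefl) Mx]].
  have [Lx|Rx] := residue_cover Sx Mx; first by left.
  have RE : residue_fam (pickle M) = residue M by rewrite /residue_fam pickleK.
  have [[i [Ii LR]]|no] := pselect (exists i, I_set i /\ L_fam i = residue M).
    by left; exists i => //; rewrite LR.
  (* The residue of M appears in the family under its first valid index. *)
  right; have valid : J_valid (pickle M).
    split; first by exists M => //; rewrite pickleK.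
    by move=> i Ii h; apply: no; exists i; rewrite h.
  have ex : exists j, `[< J_valid j /\ residue_fam j = residue M >].
    by exists (pickle M); apply/asboolP.
  case: (ex_minnP ex) => j /asboolP[vj jM] jmin; exists j; last by rewrite jM.
  split => // j' vj' j'E; apply: jmin; apply/asboolP; split => //.
  by rewrite j'E.
- move=> i [t -> t0] T T0; have [_ LE _] := I_setP t0; rewrite LE.
  apply/seteqP; split=> [x [Sx clx]|]; last first.
    apply: rel_closed_contains; first exact: piece_rel_closed.
    by move=> x [j _ []].
  split=> // B Bx; have [y [ty By]] := clx _ (nbhs_interior Bx).
  have [t' [z [tz t'z Bz Tz]]] := core_dense_crossing T ty By.
  have [It' LE' mE'] := I_setP (ex_intro _ z t'z : core t' !=set0).
  exists z; split => //; exists (pickle t') => /=; first by rewrite mE'.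
  by rewrite LE'; split; exact: core_sub_piece.
- move=> i [t -> t0] F F' finF finF' FI FJ nF; have [_ LE _] := I_setP t0; rewrite LE.
  apply/seteqP; split=> [x tx|]; last first.
    apply: rel_closed_contains; first exact: piece_rel_closed.
    by move=> x [].
  split=> [|B Bx]; first by case: tx.
  have [|Z|y [By ty av]] := @thin_escape t (L_fam @` F `|` residue_fam @` F') x B _ _ tx Bx.
  + by rewrite finite_setU; split; exact: finite_image.
  + move=> [[j Fj <-]|[j Fj <-]].
      split; last by apply: L_rel_closed; exact: FI.
      by apply: L_thin; [exact: FI|move=> h; apply: nF; rewrite -h].
    split; last by apply: residue_fam_rel_closed; exact: FJ.
    by apply: R_thin; exact: FJ.
  exists y; split => //; split; first exact: core_sub_piece.
  by move=> [[j Fj]|[j Fj]]; apply: av; [left|right]; exists j.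
- apply/seteqP; split=> [x []//|x Sx]; split => // B Bx.
  have [t [y [ty By]]] := cores_dense Sx Bx.
  have [It LE _] := I_setP (ex_intro _ y ty : core t !=set0).
  by exists y; split => //; exists (pickle t) => //; rewrite LE; exact: core_sub_piece.
Qed.

End construction.

(** * Finiteness of balls of integer vectors, and the exponents *)

Lemma hyperplane_rational_affine (R : realType) (n : nat) (m : 'rV[int]_n.+1) :
  rational_affine_subspace (@hyperplane R n m).
Proof.
exists 1%N, (\matrix_(i < n, j < 1) (normal_part m 0 i)%:~R), (\row_(j < 1) (m 0 ord0)%:~R).
have E (x : 'rV[R]_n) : (x *m map_mx ratr (\matrix_(i < n, j < 1) (normal_part m 0 i)%:~R)) 0 0 =
    dotz (normal_part m) x.
  by rewrite mxE; apply: eq_bigr => i _; rewrite !mxE ratr_int mulrC.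
apply/seteqP; split => x; rewrite /hyperplane /=.
  move=> h; apply/rowP => i; rewrite ord1 E h !mxE; by rewrite ratr_int.
by move=> /rowP/(_ 0); rewrite E => ->; rewrite !mxE ratr_int.
Qed.

Lemma hyperplane_neqT (R : realType) (n : nat) (m : 'rV[int]_n.+1) :
  normal_part m != 0 -> @hyperplane R n m <> setT.
Proof.
move=> m0 hT; have all x : dotz (normal_part m) x = (m 0 ord0)%:~R :> R.
  by have : hyperplane m x by rewrite hT.
have dot0 : dotz (normal_part m) (0 : 'rV[R]_n) = 0.
  by rewrite /dotz big1// => i _; rewrite [X in _ * X]mxE mulr0.
move/eqP: m0; apply; apply/rowP => j; rewrite [RHS]mxE.
have dotj : dotz (normal_part m) ('e_j : 'rV[R]_n) = (normal_part m 0 j)%:~R.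
  rewrite /dotz (bigD1 j)//= big1 => [|i ij].
    by rewrite [X in _ * X]mxE !eqxx mulr1 addr0.
  by rewrite [X in _ * X]mxE (negbTE ij) andbF mulr0.
by apply/eqP; rewrite -(intr_eq0 R) -dotj all -(all 0) dot0.
Qed.

Lemma finite_int_box (R : realType) (n : nat) (B : R) :
  finite_set [set q : 'rV[int]_n | forall j, `|(q 0 j)%:~R| <= B].
Proof.
pose N := (Num.truncn B).+1.
pose f (g : {ffun 'I_n -> 'I_(N.*2.+1)}) : 'rV[int]_n := \row_j ((g j)%:Z - N%:Z).
apply: (@sub_finite_set _ _ (f @` setT)); last exact/finite_image/finite_finset.
move=> q qB; have B0 j : 0 <= B := le_trans (normr_ge0 _) (qB j).
have qN j : leq (absz (q 0 j)) N.
  rewrite -(ler_nat R) pmulrn abszE intr_norm (le_trans (qB j))//.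
  by have /andP[_ /ltW] := truncn_itv (B0 j).
exists [ffun j => inord (absz (q 0 j + N%:Z))] => //.
apply/rowP => j; rewrite !mxE ffunE inordK; have := qN j; lia.
Qed.

Lemma int_vector_coord_neq0 (n : nat) (q : 'rV[int]_n) : q != 0 -> exists j, q 0 j != 0.
Proof.
move=> q0; apply/existsP; apply: contra_neqT q0; rewrite negb_exists => /forallP h.
by apply/rowP => j; rewrite mxE; apply/eqP; have := h j; rewrite negbK.
Qed.

Lemma znorm_gt0 (R : realType) (n : nat) (q : 'rV[int]_n) : q != 0 -> 0 < znorm R q.
Proof.
move=> /int_vector_coord_neq0[j qj]; apply: lt_le_trans (rV_coord_le_norm _ j).
by rewrite mxE normr_gt0 intr_eq0.
Qed.

Lemma finite_znorm_le (R : realType) (n : nat) (C : R) :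
  finite_set [set q : 'rV[int]_n | q != 0 /\ znorm R q <= C].
Proof.
apply: sub_finite_set (finite_int_box n C) => q [_ qC] j /=.
by apply: le_trans qC; apply: le_trans (rV_coord_le_norm _ j); rewrite mxE.
Qed.

Section weights.
Context (R : realType) (n : nat) (s : 'rV[R]_n).
Hypothesis s_weights : weights s.

Let s_gt0 j : 0 < s 0 j. Proof. by have [/(_ j)/andP[]] := s_weights. Qed.

Lemma weighted_norm_gt0 (q : 'rV[int]_n) :
  q != 0 -> 0 < weighted_norm s (map_mx intr q).
Proof.
move=> /int_vector_coord_neq0[j qj].
apply: (@lt_le_trans _ _ (`|(map_mx intr q : 'rV[R]_n) 0 j| `^ (s 0 j)^-1)).
  by rewrite powR_gt0// mxE normr_gt0 intr_eq0.
exact: (le_bigmax_cond _ (fun j => `|(map_mx intr q : 'rV[R]_n) 0 j| `^ (s 0 j)^-1)).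
Qed.

Lemma finite_weighted_norm_le (C : R) : 0 < C ->
  finite_set [set q : 'rV[int]_n | q != 0 /\ weighted_norm s (map_mx intr q) <= C].
Proof.
move=> C0; apply: sub_finite_set (finite_int_box n (\sum_j C `^ s 0 j)) => q [_ qC] j /=.
have := (weighted_norm_leP _ s_gt0 (ltW C0)).1 qC j; rewrite mxE => h.
apply: (le_trans h); rewrite (bigD1 j)//= lerDl sumr_ge0// => i _.
exact: powR_ge0.
Qed.

End weights.

Lemma near_expRN_le_powR (R : realType) (g : R) :
  \forall t \near +oo, expR (- t) <= t `^ (- g).
Proof.
near=> t.
have t0 : 0 < t by near: t; exact: nbhs_pinfty_gt.
have : 1 * t `^ g <= expR (t `^ 1) by near: t; exact: near_powR_le_expR.
by rewrite mul1r powRr1 ?(ltW t0)// expRN powRN lef_pV2// posrE ?expR_gt0 ?powR_gt0.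
Unshelve. all: by end_near. Qed.

Lemma expRN_nincr (R : realType) (t t' : R) : 0 < t -> t <= t' -> expR (- t') <= expR (- t).
Proof. by move=> _ tt'; rewrite ler_expR lerN2. Qed.

Lemma omega_hat_star_infinite (R : realType) (n : nat) (xi : 'rV[R]_n) :
  (\forall t \near +oo, exists q, [/\ q != 0, znorm R q <= t & dist_int (dotz q xi) <= expR (- t)]) ->
  omega_hat_star xi = +oo%E.
Proof.
move=> H; apply/eqyP => g g0; apply: ereal_sup_ubound; exists g => //; split => //.
apply: filterS2 H (near_expRN_le_powR g) => t [q [q0 qt qxi]] le.
by exists q; split => //; [exact: znorm_gt0|exact: le_trans le].
Qed.

Lemma weighted_omega_hat_star_infinite (R : realType) (n : nat) (s xi : 'rV[R]_n) :
  (0 < n)%N -> weights s ->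
  (\forall t \near +oo, exists q, [/\ q != 0, weighted_norm s (map_mx intr q) <= t &
     dist_int (dotz q xi) <= expR (- t)]) ->
  weighted_omega_hat_star s xi = +oo%E.
Proof.
move=> n0 ws /near_pinftyP[M HM]; apply/eqyP => g g0; apply: ereal_sup_ubound; exists g => //=.
near=> t.
have t1 : 1 <= t by near: t; exact: nbhs_pinfty_ge.
have tn : t <= t ^+ n by rewrite -[leLHS]expr1 ler_weXn2l.
have [|q [q0 qt qxi]] := HM (t ^+ n).
  by apply: lt_le_trans tn; near: t; apply: nbhs_pinfty_gt; exact: num_real.
exists q; split => //; first exact: weighted_norm_gt0.
apply: (le_trans qxi); apply: (@le_trans _ _ (expR (- t))); first by rewrite ler_expR lerN2.
by near: t; exact: near_expRN_le_powR.
Unshelve. all: by end_near. Qed.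

Definition equal_weights (R : realType) (n : nat) : 'rV[R]_n := const_mx n%:R^-1.

Lemma equal_weights_weights (R : realType) (n : nat) : (2 <= n)%N -> weights (equal_weights R n).
Proof.
move=> n2; have n0 : 0 < n%:R :> R by rewrite ltr0n; lia.
split=> [j|]; first by rewrite mxE invr_gt0 n0 invf_lt1// ltr1n.
under eq_bigr do rewrite mxE.
by rewrite sumr_const card_ord -[_ *+ n]mulr_natr mulVf// gt_eqF.
Qed.

(** For equal weights 1/n the weighted norm is the n-th power of the max norm, and
    1/(n (1 - 1/n)) = 1/(n - 1).  The weighted exponent ranges over all real g;
    its positive lower bound provides the positive g that the other exponent
    requires. *)
Lemma omega_hat_ge (R : realType) (n : nat) (xi : 'rV[R]_n) : (2 <= n)%N ->
  (\forall t \near +oo, exists q, [/\ q != 0,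
     weighted_norm (equal_weights R n) (map_mx intr q) <= t & dist_int (dotz q xi) <= expR (- t)]) ->
  (((n%:R - 1)^-1)%:E <= omega_hat xi)%E.
Proof.
move=> n2 H; have ws := equal_weights_weights R n2.
have n0 : (0 < n)%N by lia.
have nR : 2 <= n%:R :> R by rewrite ler_nat.
have [d0 d1 ds] := min_weight_bounds n0 ws.
have dn : n%:R^-1 <= min_weight (equal_weights R n).
  apply: le_bigmin; first by rewrite invf_le1; lra.
  by move=> i _; rewrite mxE.
have b : ((n%:R - 1)^-1%:E <= weighted_omega_hat (equal_weights R n) xi)%E.
  apply: le_trans (weighted_transference n0 ws H); rewrite lee_fin lef_pV2 ?posrE.
  - rewrite mulrBr mulr1 lerD2l lerN2.
    by rewrite -[leLHS](mulfV (_ : n%:R != 0)) ?ler_pM2l// ?gt_eqF//; lra.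
  - by lra.
  - by rewrite mulr_gt0//; lra.
apply: (le_trans b).
have pos g : 0 < g -> [set g : R | \forall t \near +oo, exists q : int,
      [/\ 0 < q, q%:~R <= t &
          weighted_norm (equal_weights R n) (dist_intv (q%:~R *: xi)) <= t `^ (- (n%:R * g))]] g ->
    (g%:E <= omega_hat xi)%E.
  move=> g0 /= hg; apply: ereal_sup_ubound; exists g => //; split => //.
  apply: filterS hg => t [q [q0 qt qxi]]; exists q; split => //.
  have sg j : 0 < (equal_weights R n) 0 j by have [/(_ j)/andP[]] := ws.
  have := (weighted_norm_leP _ sg (powR_ge0 _ _)).1 qxi => h.
  rewrite [leLHS]/Num.norm /= mx_normrE; apply: bigmax_le; first exact: powR_ge0.
  move=> [i j] _ /=; rewrite ord1; apply: (le_trans (h j)).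
  rewrite -powRrM !mxE mulNr mulrAC mulfV ?mul1r// gt_eqF//; lra.
have [g0 [hg0 g0pos]] : exists g, [set g : R | \forall t \near +oo, exists q : int,
      [/\ 0 < q, q%:~R <= t &
          weighted_norm (equal_weights R n) (dist_intv (q%:~R *: xi)) <= t `^ (- (n%:R * g))]] g /\ 0 < g.
  have : (0 < weighted_omega_hat (equal_weights R n) xi)%E.
    by apply: lt_le_trans b; rewrite lte_fin invr_gt0; lra.
  by move=> /ereal_sup_gt[_ [g hg <-]]; rewrite lte_fin => g0; exists g.
apply: ge_ereal_sup => _ [g hg <-]; have [gpos|gneg] := ltP 0 g; first exact: pos.
by apply: le_trans (pos _ g0pos hg0); rewrite lee_fin; lra.
Qed.

Section main.
Context (R : realType) (n k : nat) (S : set 'rV[R]_n) (I J : set nat)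
  (L L' : nat -> set 'rV[R]_n) (m : nat -> 'rV[int]_n.+1).
Hypothesis KS : Khintchine_system S I J L L' m.
Hypothesis S_locally_closed : locally_closed S.
Hypothesis S_nonempty : S !=set0.

(** If such points formed a countable set, it could be given as the set to be
    avoided in [singular_point_exists]. *)
Lemma uncountably_many_singular (Phi : 'rV[int]_n -> R) (phi : R -> R) (P : 'rV[R]_n -> Prop) :
  (forall q, q != 0 -> 0 < Phi q) ->
  (forall C : R, 0 < C -> finite_set [set q | q != 0 /\ Phi q <= C]) ->
  (forall t, 0 < t -> 0 < phi t) ->
  (forall t t', 0 < t -> t <= t' -> phi t' <= phi t) ->
  (forall xi, (\forall t \near +oo, exists q,
     [/\ q != 0, Phi q <= t & dist_int (dotz q xi) <= phi t]) -> P xi) ->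
  uncountably_many (fun xi => [/\ S xi, totally_irrational xi & P xi]).
Proof.
move=> Phi0 Phifin phi0 phin HP /countable_injP[e einj].
have [|xi [Sxi irr nE H]] := singular_point_exists KS Phi0 Phifin phi0 phin einj _ S_locally_closed S_nonempty.
  by move=> x [_ /totally_irrational_avoids].
by apply: nE; split => //; exact: HP.
Qed.

End main.

Theorem theorem1p7 (R : realType) (n k : nat) (S : set 'rV[R]_n)
    (n_ge2 : (2 <= n)%N) (k_ge2 : (2 <= k)%N)
    (S_nonempty : S !=set0) (S_connected : connected S)
    (S_submanifold : analytic_submanifold k S)
    (S_not_in_rational : forall A : set 'rV[R]_n,
       rational_affine_subspace A -> A <> setT -> ~ S `<=` A) :
  locally_closed S /\
  (exists (I J : set nat) (L L' : nat -> set 'rV[R]_n)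
          (m : nat -> 'rV[int]_n.+1),
     Khintchine_system S I J L L' m) /\
  (forall (Phi : 'rV[int]_n -> R) (phi : R -> R),
     (forall q, q != 0 -> 0 < Phi q) ->
     (forall C : R, 0 < C -> finite_set [set q | q != 0 /\ Phi q <= C]) ->
     (forall t, 0 < t -> 0 < phi t) ->
     (forall t t', 0 < t -> t <= t' -> phi t' <= phi t) ->
     uncountably_many (fun xi =>
       [/\ S xi, totally_irrational xi &
           \forall t \near +oo, irrationality_fun Phi xi t <= phi t])) /\
  uncountably_many (fun xi =>
    [/\ S xi, totally_irrational xi & omega_hat_star xi = +oo%E]) /\
  uncountably_many (fun xi =>
    [/\ S xi, totally_irrational xi &
        (((n%:R - 1)^-1)%:E <= omega_hat xi)%E]) /\
  (forall s : 'rV[R]_n, weights s ->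
     uncountably_many (fun xi =>
       [/\ S xi, totally_irrational xi &
           weighted_omega_hat_star s xi = +oo%E])) /\
  (forall s : 'rV[R]_n, weights s ->
     uncountably_many (fun xi =>
       [/\ S xi, totally_irrational xi &
           (((n%:R * (1 - min_weight s))^-1)%:E <= weighted_omega_hat s xi)%E])).
Proof.
have n_gt0 : (0 < n)%N by exact: ltnW.
have S_hyper (m : 'rV[int]_n.+1) : hyperplane_vector m -> ~ S `<=` hyperplane m.
  move=> [_ m0]; apply: S_not_in_rational; first exact: hyperplane_rational_affine.
  exact: hyperplane_neqT.
have lcS := submanifold_locally_closed S_submanifold.
have KS := Khintchine_system_exists k_ge2 S_submanifold S_connected S_hyper.
have many := uncountably_many_singular KS lcS S_nonempty.
have many_exp (Phi : 'rV[int]_n -> R) P := fun h0 hfin =>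
  many Phi (fun t => expR (- t)) P h0 hfin (fun t _ => expR_gt0 (- t)) (@expRN_nincr R).
split=> //; split; first by exists (I_set k S), (J_set k S), (L_fam k S), (residue_fam k S), (@m_fam n).
split.
  move=> Phi phi Phi0 Phifin phi0 phin; apply: (many Phi phi) => // xi.
  apply: filterS => t [q [q0 qt qxi]]; apply: le_trans qxi.
  apply: ge_inf; last by exists q.
  by exists 0 => _ [w _ <-]; exact: dist_int_ge0.
split.
  apply: (many_exp (@znorm R n)) => [|C _|xi].
  - exact: znorm_gt0.
  - exact: finite_znorm_le.
  - exact: omega_hat_star_infinite.
split.
  have ws := equal_weights_weights R n_ge2.
  apply: (many_exp (fun q => weighted_norm (equal_weights R n) (map_mx intr q))) => [||xi].
  - exact: weighted_norm_gt0.
  - exact: finite_weighted_norm_le.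
  - exact: omega_hat_ge.
split=> s ws; apply: (many_exp (fun q => weighted_norm s (map_mx intr q))) => [||xi].
- exact: weighted_norm_gt0.
- exact: finite_weighted_norm_le.
- exact: weighted_omega_hat_star_infinite.
- exact: weighted_norm_gt0.
- exact: finite_weighted_norm_le.
- exact: weighted_transference.
Qed.
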